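(* Let $d,n\geqslant1$ be integers, $m>0$, $a\in\mathcal{S}(\Sigma_m)$, and let $u=u^a$ be the solution of $(\Delta_t-\Delta_x+m^2)u=0$ in $\mathbb{R}^d\times\mathbb{R}^n$ defined in the context. Then for all unit vectors $(\theta,\omega)\in S^{d-1}\times S^{n-1}$, every $q\in\mathbb{R}$ and every $N$, $$u\big((s+q)\theta,\,s\omega\big)=O(s^{-N}),\qquad s\to+\infty.$$
   Context: Points of $\mathbb{R}^d\times\mathbb{R}^n$ are written $(x,t)$; $\Delta_x=\partial_{x_1}^2+\dots+\partial_{x_d}^2$, $\Delta_t=\partial_{t_1}^2+\dots+\partial_{t_n}^2$. $S^{k-1}$ is the unit sphere in $\mathbb{R}^k$. For a vector $\xi$, $\xi^2:=|\xi|^2$. $dS$ is the surface measure on $S^{n-1}$ induced by the Euclidean metric; for $n=1$, $S^0=\{\pm1\}$ and $dS$ is the counting measure. $\Sigma_m=\{(\xi,\tau)\in\mathbb{R}^d\times\mathbb{R}^n : \xi^2+m^2-|\tau|^2=0\}$. To a function $a$ on $\Sigma_m$ one associates the function on $\mathbb{R}^d\times S^{n-1}$ $$A(\xi,\sigma)=\tfrac12(\xi^2+m^2)^{n/2-1}\,a\big(\xi,\sigma\sqrt{\xi^2+m^2}\big).$$ $\mathcal{S}(\Sigma_m)$ is the set of functions $a$ on $\Sigma_m$ for which $A\in\mathcal{S}(\mathbb{R}^d\times S^{n-1})$, i.e. $A$ is smooth and all its derivatives in $\xi$ and (in local coordinates of a finite atlas, after multiplication by a subordinate partition of unity) in $\sigma$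 decay faster than any power of $1+|\xi|$, uniformly in $\sigma$. The function $u^a$ is $$u^a(x,t)=(2\pi)^{-d-n}\int_{\mathbb{R}^d\times S^{n-1}}e^{i\left(\langle x,\xi\rangle-\langle t,\sigma\rangle\sqrt{\xi^2+m^2}\right)}A(\xi,\sigma)\,d\xi\,dS_\sigma .$$ *)

(* Defs.v *)
From HB Require Import structures.
From mathcomp Require Import all_boot all_order all_algebra.
From mathcomp Require Import complex.
From mathcomp Require Import all_classical all_reals all_analysis.
From mathcomp Require Import measurable_realfun.

Set Implicit Arguments.
Unset Strict Implicit.
Unset Printing Implicit Defensive.

Import Order.TTheory GRing.Theory Num.Theory.
Import numFieldNormedType.Exports.

Local Open Scope classical_set_scope.
Local Open Scope ring_scope.
Local Open Scope complex_scope.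

(** The norm [`|x|] of ['rV[R]_n] in the library is the sup norm, so the
    Euclidean norm needs its own name. *)

Definition dotp (R : realType) (n : nat) (x y : 'rV[R]_n) : R :=
  \sum_(i < n) x 0 i * y 0 i.

Definition enorm (R : realType) (n : nat) (x : 'rV[R]_n) : R :=
  Num.sqrt (dotp x x).

Definition sphere (R : realType) (n : nat) : set 'rV[R]_n :=
  [set x | enorm x = 1].

Definition uball (R : realType) (n : nat) : set 'rV[R]_n :=
  [set y | enorm y < 1].

Definition insert (R : realType) (n : nat) (j : 'I_n.+1) (a : R)
    (y : 'rV[R]_n) : 'rV[R]_n.+1 :=
  \row_i (if unlift j i is Some k then y 0 k else a).

(** ['rV[R]_n] carries the sigma-algebra generated by the coordinates, which
    is the Borel sigma-algebra; [leb R n] below is the n-fold product of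
    one-dimensional Lebesgue measure, built coordinate by coordinate. *)

Definition rV_coord (R : realType) (n : nat) (i : 'I_n) (x : 'rV[R]_n) :
  measurableTypeR R := x 0 i.

Definition measure_rV_display : measure_display.
Proof. exact: default_measure_display. Qed.

Section measurable_rV.
Variables (R : realType) (n : nat).

Let rV_set0 : g_sigma_preimage (@rV_coord R n) set0.
Proof. exact: sigma_algebra0. Qed.

Let rV_setC A :
  g_sigma_preimage (@rV_coord R n) A -> g_sigma_preimage (@rV_coord R n) (~` A).
Proof. exact: sigma_algebraC. Qed.

Let rV_bigcup (F : (set 'rV[R]_n)^nat) :
  (forall i, g_sigma_preimage (@rV_coord R n) (F i)) ->
  g_sigma_preimage (@rV_coord R n) (\bigcup_i (F i)).
Proof. exact: sigma_algebra_bigcup. Qed.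

HB.instance Definition _ := @isMeasurable.Build measure_rV_display
  'rV[R]_n (g_sigma_preimage (@rV_coord R n)) rV_set0 rV_setC rV_bigcup.

End measurable_rV.

Lemma measurable_rV_coord (R : realType) (n : nat) (i : 'I_n) :
  measurable_fun [set: 'rV[R]_n] (@rV_coord R n i).
Proof.
move=> _ Y mY; rewrite setTI; apply: sub_sigma_algebra => /=.
rewrite -bigcup_seq/=; exists i => /=; first by rewrite mem_index_enum.
by exists Y => //; rewrite setTI.
Qed.

Lemma measurable_fun_rVP (d1 : measure_display) (T1 : measurableType d1)
    (R : realType) (n : nat) (f : T1 -> 'rV[R]_n) :
  measurable_fun [set: T1] f <->
  forall i, measurable_fun [set: T1] (@rV_coord R n i \o f).
Proof.
split=> [mf i|mf].
  by apply: measurableT_comp => //; exact: measurable_rV_coord.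
apply: (@measurability _ _ _ _ _ _
  (\big[setU/set0]_(i < n) preimage_set_system setT (@rV_coord R n i)
     measurable)) => //.
move=> _ [A + <-].
case: n => [|n] in f mf A *; first by rewrite big_ord0.
rewrite -bigcup_mkord_ord => -[i Ii [B mB <-]].
by rewrite !setTI -comp_preimage -[X in measurable X]setTI; exact: mf.
Qed.

Lemma measurable_insert (R : realType) (n : nat) (j : 'I_n.+1)
    (d1 : measure_display) (T1 : measurableType d1)
    (f : T1 -> measurableTypeR R) (g : T1 -> 'rV[R]_n) :
  measurable_fun setT f -> measurable_fun setT g ->
  measurable_fun setT (fun t => insert j (f t) (g t)).
Proof.
move=> mf /measurable_fun_rVP mg; apply/measurable_fun_rVP => i.
rewrite (_ : _ \o _ =
    fun t => if unlift j i is Some k then (g t) 0 k else f t); last first.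
  by apply/funext => t /=; rewrite /rV_coord mxE.
by case: (unlift j i) => // k; exact: mg.
Qed.

Section leb_step.
Variables (R : realType) (n : nat).
Variable mu : {sigma_finite_measure set 'rV[R]_n -> \bar R}.

Definition leb_cons (p : measurableTypeR R * 'rV[R]_n) : 'rV[R]_n.+1 :=
  insert ord0 p.1 p.2.

Lemma measurable_leb_cons : measurable_fun setT leb_cons.
Proof. exact: measurable_insert. Qed.

Definition leb_uncons (x : 'rV[R]_n.+1) : measurableTypeR R * 'rV[R]_n :=
  (x 0 ord0, \row_k x 0 (lift ord0 k)).

Lemma measurable_leb_uncons : measurable_fun setT leb_uncons.
Proof.
apply: measurable_fun_pair; first exact: (measurable_rV_coord ord0).
apply/measurable_fun_rVP => i.
rewrite (_ : _ \o _ = rV_coord (lift ord0 i)); first exact: measurable_rV_coord.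
by apply/funext => x; rewrite /= /rV_coord mxE.
Qed.

Lemma leb_consK : cancel leb_cons leb_uncons.
Proof.
move=> [a y]; rewrite /leb_uncons /leb_cons /=; congr pair.
  by rewrite mxE unlift_none.
by apply/rowP => k; rewrite !mxE liftK.
Qed.

Definition leb_step : set 'rV[R]_n.+1 -> \bar R :=
  pushforward (lebesgue_measure \x mu)%E leb_cons.

Let leb_step0 : leb_step set0 = 0%E.
Proof. by rewrite /leb_step /pushforward preimage_set0 measure0. Qed.

Let leb_step_ge0 A : (0 <= leb_step A)%E.
Proof. by rewrite /leb_step /pushforward; exact: measure_ge0. Qed.

Let leb_step_sigma_additive : semi_sigma_additive leb_step.
Proof.
have mpre A : measurable A -> measurable (leb_cons @^-1` A).
  by move=> mA; rewrite -[X in measurable X]setTI; exact: measurable_leb_cons.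
move=> F mF tF mUF; rewrite /leb_step /pushforward preimage_bigcup.
apply: measure_semi_sigma_additive.
- by move=> k; exact: mpre.
- apply/trivIsetP => /= i j _ _ ij; rewrite -preimage_setI.
  by move/trivIsetP : tF => /(_ _ _ _ _ ij) ->//; rewrite preimage_set0.
- by rewrite -preimage_bigcup; exact: mpre.
Qed.

HB.instance Definition _ := isMeasure.Build _ _ _
  leb_step leb_step0 leb_step_ge0 leb_step_sigma_additive.

Let leb_step_sigma_finite : sigma_finite setT leb_step.
Proof.
have /sigma_finiteP[F [TF ndF Foo]] : sigma_finite setT (@lebesgue_measure R).
  exact: sigma_finiteT.
have /sigma_finiteP[G [TG ndG Goo]] := sigma_finiteT mu.
exists (fun k => leb_uncons @^-1` (F k `*` G k)).
  rewrite predeqE => x; split=> // _.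
  have [k _ Fk] : (\bigcup_i F i) (leb_uncons x).1 by rewrite -TF.
  have [l _ Gl] : (\bigcup_i G i) (leb_uncons x).2 by rewrite -TG.
  exists (maxn k l) => //; split => /=.
    by move: Fk; exact/subsetPset/ndF/leq_maxl.
  by move: Gl; exact/subsetPset/ndG/leq_maxr.
move=> k; have [mF Fk] := Foo k; have [mG Gk] := Goo k.
have mFG : measurable (F k `*` G k) by exact: measurableX.
split; first by rewrite -[X in measurable X]setTI; exact: measurable_leb_uncons.
rewrite /leb_step /pushforward -comp_preimage (_ : _ \o _ = id); last first.
  by apply/funext => p; exact: leb_consK.
by rewrite preimage_id product_measure1E// lte_mul_pinfty// ge0_fin_numE.
Qed.

HB.instance Definition _ :=
  @Measure_isSigmaFinite.Build _ _ _ leb_step leb_step_sigma_finite.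

End leb_step.

Fixpoint leb (R : realType) (n : nat) :
    {sigma_finite_measure set 'rV[R]_n -> \bar R} :=
  match n return {sigma_finite_measure set 'rV[R]_n -> \bar R} with
  | 0 => dirac (0 : 'rV[R]_0)
  | k.+1 => leb_step (leb R k)
  end.

(** The atlas of the sphere consists of the open hemispheres [{s | s_j > 0}]
    and [{s | s_j < 0}], each the graph of [+/- sqrt (1 - |y|^2)] over the
    open unit ball of the hyperplane [s_j = 0]. *)

Definition hemisphere (R : realType) (n : nat) (c : 'I_n.+1 * bool) :
    set 'rV[R]_n.+1 :=
  [set s | sphere s /\ 0 < (-1) ^+ c.2 * s 0 c.1].

Definition chart (R : realType) (n : nat) (c : 'I_n.+1 * bool)
    (y : 'rV[R]_n) : 'rV[R]_n.+1 :=
  insert c.1 ((-1) ^+ c.2 * Num.sqrt (1 - dotp y y)) y.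

(** The Euclidean metric induces on the graph of [h] the area element
    [sqrt (1 + |grad h|^2) dy]; this is its value for
    [h y = +/- sqrt (1 - |y|^2)]. *)
Definition area_density (R : realType) (n : nat) (y : 'rV[R]_n) : R :=
  (Num.sqrt (1 - dotp y y))^-1.

Lemma measurable_dotp (R : realType) (n : nat) :
  measurable_fun setT (fun y : 'rV[R]_n => dotp y y).
Proof.
apply: measurable_sum => i; apply: measurable_funM; exact: measurable_rV_coord.
Qed.

Lemma measurable_sqrt (R : realType) : measurable_fun setT (@Num.sqrt R).
Proof.
apply: continuous_measurable_fun => x; exact: sqrt_continuous.
Qed.

Lemma measurable_gap (R : realType) (n : nat) :
  measurable_fun setT (fun y : 'rV[R]_n => Num.sqrt (1 - dotp y y)).
Proof.
apply: measurableT_comp; first exact: measurable_sqrt.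
by apply: measurable_funB => //; exact: measurable_dotp.
Qed.

Lemma measurable_area_density (R : realType) (n : nat) :
  measurable_fun setT (@area_density R n).
Proof.
rewrite (_ : @area_density R n =
    (fun z => z `^ (-1)) \o (fun y => Num.sqrt (1 - dotp y y))); last first.
  by apply/funext => y /=; rewrite powR_inv1// sqrtr_ge0.
by apply: measurableT_comp; [exact: measurable_powR|exact: measurable_gap].
Qed.

Lemma area_density_ge0 (R : realType) (n : nat) (y : 'rV[R]_n) :
  0 <= area_density y.
Proof. by rewrite invr_ge0 sqrtr_ge0. Qed.

Lemma measurable_chart (R : realType) (n : nat) (c : 'I_n.+1 * bool) :
  measurable_fun setT (@chart R n c).
Proof.
apply: measurable_insert => //.
by apply: measurable_funM => //; exact: measurable_gap.
Qed.

Lemma measurable_uball (R : realType) (n : nat) : measurable (@uball R n).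
Proof.
have /(_ measurableT [set true]) : measurable_fun setT
    (fun y : 'rV[R]_n => Num.sqrt (dotp y y) < 1).
  apply: measurable_fun_ltr => //.
  by apply: measurableT_comp; [exact: measurable_sqrt|exact: measurable_dotp].
rewrite setTI; exact.
Qed.

Section sphere_measure.
Variables (R : realType) (n : nat).
Local Open Scope ereal_scope.

(** [b = false]: hemisphere [s_0 > 0]; [b = true]: hemisphere [s_0 < 0] *)
Definition sphere_half (b : bool) (E : set 'rV[R]_n.+1) : \bar R :=
  \int[leb R n]_(y in @uball R n `&` chart (ord0, b) @^-1` E)
    (area_density y)%:E.

Section half_measure.
Variable b : bool.

Let half0 : sphere_half b set0 = 0.
Proof. by rewrite /sphere_half preimage_set0 setI0 integral_set0. Qed.

Let half_ge0 E : 0 <= sphere_half b E.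
Proof.
by apply: integral_ge0 => y _; rewrite lee_fin; exact: area_density_ge0.
Qed.

Let mpre (E : set 'rV[R]_n.+1) : measurable E ->
  measurable (@uball R n `&` chart (ord0, b) @^-1` E).
Proof.
move=> mE; apply: measurableI; first exact: measurable_uball.
by rewrite -[X in measurable X]setTI; exact: measurable_chart.
Qed.

Let half_sigma_additive : semi_sigma_additive (sphere_half b).
Proof.
move=> F mF tF mUF.
rewrite [X in _ --> X](_ : _ = \sum_(k <oo) sphere_half b (F k)).
  by apply/cvg_closeP; split; [exact: is_cvg_nneseries|rewrite closeE].
rewrite /sphere_half preimage_bigcup setI_bigcupr ge0_integral_bigcup//.
- by move=> k; exact: mpre.
- apply/measurable_EFinP; apply: measurable_funTS.
  exact: measurable_area_density.
- by move=> y _; rewrite lee_fin; exact: area_density_ge0.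
- apply/trivIsetP => i j _ _ ij.
  rewrite setIACA -(preimage_setI (chart (ord0, b))).
  by move/trivIsetP : tF => /(_ _ _ _ _ ij) ->//; rewrite preimage_set0 setI0.
Qed.

HB.instance Definition _ := isMeasure.Build _ _ _
  (sphere_half b) half0 half_ge0 half_sigma_additive.

End half_measure.

(** The equator [{s | s_0 = 0}], which neither half sees, is a null set of the
    surface measure (and is empty when the sphere is [{-1, 1}]). This is a
    measure on the ambient space, concentrated on the sphere. *)
Definition sphere_measure : set 'rV[R]_n.+1 -> \bar R :=
  measure_add (sphere_half false) (sphere_half true).

HB.instance Definition _ := Measure.on sphere_measure.

Let sphere_measure_sigma_finite : sigma_finite setT sphere_measure.
Proof.
have /sigma_finiteP[G [TG ndG Goo]] := sigma_finiteT (leb R n).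
pose pr (s : 'rV[R]_n.+1) := (leb_uncons s).2.
have mpr : measurable_fun setT pr.
  by apply: measurableT_comp => //; exact: measurable_leb_uncons.
have prK b y : pr (chart (ord0, b) y) = y.
  by apply/rowP => k; rewrite !mxE liftK.
pose H k := [set y | (area_density (y : 'rV[R]_n) <= k%:R)%R].
have mH k : measurable (H k).
  have /(_ measurableT [set true]) : measurable_fun setT
      (fun y : 'rV[R]_n => (area_density y <= k%:R)%R).
    by apply: measurable_fun_ler => //; exact: measurable_area_density.
  by rewrite setTI; exact.
exists (fun k => pr @^-1` (G k `&` H k)).
  rewrite predeqE => s; split=> // _.
  have [k _ Gk] : (\bigcup_i G i) (pr s) by rewrite -TG.
  have [l Hl] : exists l, H l (pr s).
    exists (Num.bound (area_density (pr s))).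
    exact/ltW/archi_boundP/area_density_ge0.
  exists (maxn k l) => //; split => /=.
    by move: Gk; exact/subsetPset/ndG/leq_maxl.
  by apply: (le_trans Hl); rewrite ler_nat leq_maxr.
move=> k; have [mG Gk] := Goo k.
have mGH : measurable (G k `&` H k) by exact: measurableI.
split; first by rewrite -[X in measurable X]setTI; exact: mpr.
have half_fin b : sphere_half b (pr @^-1` (G k `&` H k)) < +oo.
  rewrite /sphere_half -comp_preimage (_ : pr \o _ = id); last first.
    by apply/funext => y; exact: prK.
  rewrite preimage_id.
  have mD : measurable (@uball R n `&` (G k `&` H k)).
    by apply: measurableI => //; exact: measurable_uball.
  apply: (@le_lt_trans _ _
      (\int[leb R n]_(y in @uball R n `&` (G k `&` H k)) (k%:R)%:E)).
    apply: ge0_le_integral => //.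
    - by move=> y _; rewrite lee_fin; exact: area_density_ge0.
    - apply/measurable_EFinP; apply: measurable_funTS.
      exact: measurable_area_density.
    - by move=> y [_ [_ Hy]]; rewrite lee_fin.
  rewrite integral_cst// lte_mul_pinfty//.
  apply: le_lt_trans Gk; apply: le_measure; rewrite ?inE//.
  by move=> y [_ []].
by rewrite /sphere_measure measure_addE; apply: lte_add_pinfty; exact: half_fin.
Qed.

HB.instance Definition _ := @Measure_isSigmaFinite.Build _ _ _
  sphere_measure sphere_measure_sigma_finite.

End sphere_measure.

(** On the sphere [{-1, 1}] the surface measure is the counting measure. *)
Lemma sphere_measure_dim0 (R : realType) (E : set 'rV[R]_1) :
  measurable E ->
  sphere_measure E = (\d_(const_mx 1%R : 'rV[R]_1) E +
                      \d_(const_mx (- 1)%R : 'rV[R]_1) E)%E.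
Proof.
move=> mE.
transitivity (sphere_half false E + sphere_half true E)%E.
  exact: measure_addE.
have dot0 (y : 'rV[R]_0) : dotp y y = 0 by rewrite /dotp big_ord0.
have uballT : @uball R 0 = setT.
  by apply/seteqP; split=> // y _; rewrite /uball /= /enorm dot0 sqrtr0 ltr01.
have chartE b (y : 'rV[R]_0) : chart (ord0, b) y = const_mx ((-1) ^+ b).
  apply/rowP => i; rewrite !mxE dot0 subr0 sqrtr1 mulr1.
  by case: unliftP => // -[].
have halfE b : sphere_half b E = \d_(const_mx ((-1) ^+ b) : 'rV[R]_1) E.
  rewrite /sphere_half uballT setTI.
  under eq_integral => y _ do rewrite /area_density dot0 subr0 sqrtr1 invr1.
  rewrite integral_cst ?mul1e /= ?diracE; last first.
    by rewrite -[X in measurable X]setTI; exact: measurable_chart.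
  by congr (_%:E); congr (nat_of_bool _)%:R; apply/idP/idP;
    rewrite !inE /= chartE.
by rewrite !halfE expr0 expr1.
Qed.

Definition iter_derive (R : realType) (V : normedModType R) (vs : seq V)
    (f : V -> R) : V -> R :=
  foldr (fun v (g : V -> R) => 'D_v g) f vs.

(** This is [C^oo] when [D] is open: all iterated directional derivatives (not
    only those along basis vectors) exist and are continuous on [D]. *)
Definition smooth_on (R : realType) (V : normedModType R) (D : set V)
    (f : V -> R) : Prop :=
  forall (vs : seq V) (x : V), D x ->
    {for x, continuous (iter_derive vs f)} /\
    forall v : V, derivable (iter_derive vs f) x v.

(** Decay is required in the first variable only, uniformly in the second
    one: this is applied to functions supported in [|y| <= r] with [r < 1]. *)
Definition schwartz (R : realType) (k l : nat)
    (f : 'rV[R]_k * 'rV[R]_l -> R) : Prop :=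
  smooth_on setT f /\
  forall (vs : seq ('rV[R]_k * 'rV[R]_l)) (N : nat),
    exists C : R, forall (xi : 'rV[R]_k) (y : 'rV[R]_l),
      (1 + enorm xi) ^+ N * `|iter_derive vs f (xi, y)| <= C.

Definition smooth_sphere (R : realType) (n : nat) (f : 'rV[R]_n.+1 -> R) :
    Prop :=
  forall c : 'I_n.+1 * bool, smooth_on (@uball R n) (f \o chart c).

Definition partition_of_unity (R : realType) (n : nat)
    (chi : 'I_n.+1 * bool -> 'rV[R]_n.+1 -> R) : Prop :=
  [/\ forall c, smooth_sphere (chi c),
      forall c s, sphere s -> 0 <= chi c s,
      forall s, sphere s -> \sum_c chi c s = 1 &
      forall c, closure [set s | sphere s /\ chi c s != 0]
                  `<=` hemisphere c].

(** [chi * g] read in the chart [c] and extended by zero to ['rV[R]_n]; since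
    [chi] is supported in the hemisphere [c], no smoothness is lost at the
    boundary of the ball *)
Definition localize (R : realType) (d n : nat) (c : 'I_n.+1 * bool)
    (chi : 'rV[R]_n.+1 -> R) (g : 'rV[R]_d * 'rV[R]_n.+1 -> R)
    (p : 'rV[R]_d * 'rV[R]_n) : R :=
  if enorm p.2 < 1 then chi (chart c p.2) * g (p.1, chart c p.2) else 0.

Definition schwartz_sphere (R : realType) (d n : nat)
    (A : 'rV[R]_d * 'rV[R]_n.+1 -> R[i]) : Prop :=
  exists2 chi : 'I_n.+1 * bool -> 'rV[R]_n.+1 -> R, partition_of_unity chi &
    forall c, schwartz (localize c (chi c) (fun p => complex.Re (A p))) /\
              schwartz (localize c (chi c) (fun p => complex.Im (A p))).

Definition hyperboloid (R : realType) (d n : nat) (m : R) :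
    set ('rV[R]_d * 'rV[R]_n) :=
  [set p | dotp p.1 p.1 + m ^+ 2 - dotp p.2 p.2 = 0].

Definition energy (R : realType) (d : nat) (m : R) (xi : 'rV[R]_d) : R :=
  Num.sqrt (dotp xi xi + m ^+ 2).

Lemma hyperboloid_energy (R : realType) (d n : nat) (m : R)
    (xi : 'rV[R]_d) (s : 'rV[R]_n) :
  sphere s -> hyperboloid m (xi, energy m xi *: s).
Proof.
have dot_ge0 k (x : 'rV[R]_k) : 0 <= dotp x x.
  by apply: sumr_ge0 => i _; rewrite -expr2 sqr_ge0.
rewrite /sphere /hyperboloid /= => s1.
have {}s1 : dotp s s = 1 by rewrite -[LHS]sqr_sqrtr// -/(enorm s) s1 expr1n.
rewrite (_ : dotp (_ *: s) _ = energy m xi ^+ 2 * dotp s s); last first.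
  by rewrite mulr_sumr; apply: eq_bigr => i _; rewrite !mxE mulrACA expr2.
by rewrite s1 mulr1 sqr_sqrtr ?subrr// addr_ge0 ?sqr_ge0.
Qed.

(** A function on the hyperboloid is represented by a function on the ambient
    space; by [hyperboloid_energy], only its values on the hyperboloid enter
    the values of [amplitude] on ['rV[R]_d * sphere]. *)
Definition amplitude (R : realType) (d n : nat) (m : R)
    (a : 'rV[R]_d * 'rV[R]_n -> R[i]) (p : 'rV[R]_d * 'rV[R]_n) : R[i] :=
  (2^-1 * (dotp p.1 p.1 + m ^+ 2) `^ (n%:R / 2 - 1))%:C *
  a (p.1, energy m p.1 *: p.2).

Definition schwartz_hyperboloid (R : realType) (d n : nat) (m : R)
    (a : 'rV[R]_d * 'rV[R]_n.+1 -> R[i]) : Prop :=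
  schwartz_sphere (amplitude m a).

Definition expi (R : realType) (x : R) : R[i] := cos x +i* sin x.

Definition Cintegral (disp : measure_display) (T : measurableType disp)
    (R : realType) (mu : {measure set T -> \bar R}) (D : set T)
    (f : T -> R[i]) : R[i] :=
  (\int[mu]_(p in D) complex.Re (f p)) +i* (\int[mu]_(p in D) complex.Im (f p)).

Definition solution (R : realType) (d n : nat) (m : R)
    (a : 'rV[R]_d * 'rV[R]_n.+1 -> R[i])
    (x : 'rV[R]_d) (t : 'rV[R]_n.+1) : R[i] :=
  ((2 * pi) ^- (d + n.+1))%:C *
  Cintegral (leb R d \x @sphere_measure R n)%E
    ([set: 'rV[R]_d] `*` @sphere R n.+1)
    (fun p => expi (dotp x p.1 - dotp t p.2 * energy m p.1) *
              amplitude m a p).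

(* Main.v *)
Require Import Defs.
From mathcomp Require Import all_boot all_order all_algebra.
From mathcomp Require Import complex ring lra.
From mathcomp Require Import all_classical all_reals all_analysis.
From mathcomp Require Import measurable_realfun.

Set Implicit Arguments.
Unset Strict Implicit.
Unset Printing Implicit Defensive.

Import Order.TTheory GRing.Theory Num.Theory.
Import numFieldNormedType.Exports.

Local Open Scope classical_set_scope.
Local Open Scope ring_scope.
Local Open Scope complex_scope.

(** Write [l xi = <theta, xi>], [E xi = sqrt (|xi|^2 + m^2)] and
    [c sigma = <omega, sigma>].  Along the ray the exponent is
    [s * (l xi - c sigma * E xi) + q * l xi].  The derivative of the phase
    [l - c E] in the direction [theta] is [1 - c l / E], which is at least
    [m^2 / (2 E^2)] because [|c| <= 1] and [|l| <= |xi| < E]: the phase is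
    nowhere stationary in [xi], and the inverse of its slope grows at most
    polynomially.  Integrating by parts along [theta] repeatedly therefore
    gains a power of [s] each time, and the amplitude, which decays rapidly
    together with its derivatives along [theta], uniformly in [sigma], absorbs
    the polynomial growth. *)

(** Derivatives are only ever taken along [theta], so the sphere variable can be a point of an
    arbitrary measurable space [Y] with a finite measure [kappa], and the cosine [c] any measurable
    function bounded by 1. Dependence on [sigma] then needs measurability alone, which permits
    gluing the amplitude from its charts with indicator functions. Integration by parts is done
    without splitting the space into lines parallel to [theta]: the integral of a derivative along
    [theta] is a limit of integrals of difference quotients, each zero by translation invariance.
    The price is integrability on the product space, hence the finite area of the sphere, whose
    density in the chart is singular at the boundary of the ball. The factor [exp (i q l)] has
    bounded derivatives along [theta] and is absorbed into the amplitude, so that [s] multiplies the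
    phase only. Exponentials are split into cosine and sine, and all integrals are integrals of real
    functions. *)

(** * The Euclidean inner product and the polynomial weight *)

Section dot_product.
Variables (R : realType) (d : nat).
Implicit Types x y v : 'rV[R]_d.

Lemma dotp_ge0 x : 0 <= dotp x x.
Proof. by apply: sumr_ge0 => i _; rewrite -expr2 sqr_ge0. Qed.

Lemma dotpDr x y v : dotp v (x + y) = dotp v x + dotp v y.
Proof.
by rewrite -big_split; apply: eq_bigr => i _; rewrite mxE mulrDr.
Qed.

Lemma dotpZr (a : R) x v : dotp v (a *: x) = a * dotp v x.
Proof. by rewrite mulr_sumr; apply: eq_bigr => i _; rewrite mxE mulrCA. Qed.

Lemma dotpC x y : dotp x y = dotp y x.
Proof. by apply: eq_bigr => i _; rewrite mulrC. Qed.

Lemma dotpZl (a : R) x v : dotp (a *: x) v = a * dotp x v.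
Proof. by rewrite dotpC dotpZr dotpC. Qed.

Lemma dotp_sqrD x y : dotp (x + y) (x + y) = dotp x x + 2 * dotp x y + dotp y y.
Proof.
rewrite dotpDr ![dotp (x + y) _]dotpC !dotpDr [dotp y x]dotpC; ring.
Qed.

Lemma sphere_dotp v : sphere v -> dotp v v = 1.
Proof.
by rewrite /sphere/= => v1; rewrite -[LHS]sqr_sqrtr ?dotp_ge0// -/(enorm v) v1
  expr1n.
Qed.

(** The component of [x] orthogonal to [v] has squared length [|x|^2 - (v.x)^2]. *)
Lemma unit_cauchy_schwarz v x : dotp v v = 1 -> dotp v x ^+ 2 <= dotp x x.
Proof.
move=> v1; have := dotp_ge0 (x + - dotp v x *: v).
rewrite dotp_sqrD !dotpZr !dotpZl v1 [dotp x v]dotpC => h.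
rewrite -subr_ge0; apply: le_trans h _; rewrite le_eqVlt; apply/orP; left.
by apply/eqP; ring.
Qed.

(** Growth and decay are measured in powers of this polynomial rather than of [1 + |x|], which
    avoids the square root; [weight_le] links the two scales. *)
Definition weight x : R := 1 + dotp x x.

Lemma weight_ge1 x : 1 <= weight x.
Proof. by rewrite lerDl dotp_ge0. Qed.

Lemma weight_gt0 x : 0 < weight x.
Proof. exact: lt_le_trans (weight_ge1 x). Qed.

Lemma weightX_gt0 N x : 0 < weight x ^+ N.
Proof. exact/exprn_gt0/weight_gt0. Qed.

Lemma weightXr_ge1 N x : 1 <= weight x ^+ N.
Proof. exact/exprn_ege1/weight_ge1. Qed.

(** The square [|x + 2 v|^2] equals [2 |x + v|^2 + 2 |v|^2 - |x|^2]. The lemma compares decay at a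
    point with decay at its translates by at most unit length. *)
Lemma weight_translate x v : dotp v v <= 1 -> weight x <= 3 * weight (x + v).
Proof.
move=> v1.
have := dotp_ge0 (x + 2 *: v); have := dotp_ge0 (x + v).
rewrite /weight !dotp_sqrD !dotpZr !dotpZl; lra.
Qed.

End dot_product.

(** * Measurability of trigonometric functions and reciprocals *)

Section measurable_trig.
Variable R : realType.

Lemma measurable_cos : measurable_fun [set: R] (@cos R).
Proof. by apply: continuous_measurable_fun => x; exact: continuous_cos. Qed.

Lemma measurable_sin : measurable_fun [set: R] (@sin R).
Proof. by apply: continuous_measurable_fun => x; exact: continuous_sin. Qed.

Lemma measurable_invr_gt0 (d : measure_display) (T : measurableType d)
    (f : T -> R) : (forall t, 0 < f t) -> measurable_fun setT f ->
  measurable_fun setT (fun t => (f t)^-1).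
Proof.
move=> f0 mf; rewrite (_ : (fun _ => _) = (fun x => x `^ (-1)) \o f).
  by apply: measurableT_comp => //; exact: measurable_powR.
by apply/funext => t; rewrite /= powR_inv1// ltW.
Qed.

End measurable_trig.

(** * Functions with tempered or rapidly decaying derivatives along [theta] *)

Section symbols.
Variables (R : realType) (d : nat) (dY : measure_display) (Y : measurableType dY).
Variable theta : 'rV[R]_d.
Implicit Types f g : 'rV[R]_d * Y -> R.

(** Asking for the derivative at [h = 0] suffices because the base point is arbitrary;
    [deriv_along_line] recovers it at every point of the line. *)
Definition deriv_along f f' := forall xi y,
  is_derive (0 : R) 1 (fun h : R => f (xi + h *: theta, y)) (f' (xi, y)).

(** The derivative is quantified existentially, so a closure property is proved by exhibiting a
    formula for it, and iterated derivatives need no names. *)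
Fixpoint symbol (B : ('rV[R]_d * Y -> R) -> Prop) (k : nat)
    (f : 'rV[R]_d * Y -> R) : Prop :=
  B f /\ if k is k'.+1 then exists2 f', deriv_along f f' & symbol B k' f'
         else True.

(** Measurability is part of this class and of [rapid] because [Y] carries no topology; the
    constants are uniform in [Y]. *)
Definition tempered f :=
  measurable_fun [set: 'rV[R]_d * Y] f /\
  exists C N, forall p, `|f p| <= C * weight p.1 ^+ N.

Definition rapid f :=
  measurable_fun [set: 'rV[R]_d * Y] f /\
  forall N, exists C, forall p, weight p.1 ^+ N * `|f p| <= C.

Lemma deriv_alongD f f' g g' : deriv_along f f' -> deriv_along g g' ->
  deriv_along (fun p => f p + g p) (fun p => f' p + g' p).
Proof. by move=> ff gg xi y; apply: is_deriveD. Qed.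

Lemma deriv_alongN f f' : deriv_along f f' ->
  deriv_along (fun p => - f p) (fun p => - f' p).
Proof. by move=> ff xi y; apply: is_deriveN. Qed.

Lemma deriv_alongM f f' g g' : deriv_along f f' -> deriv_along g g' ->
  deriv_along (fun p => f p * g p) (fun p => f p * g' p + g p * f' p).
Proof.
move=> ff gg xi y; apply: is_derive_eq; first by apply: is_deriveM.
by rewrite /= scale0r addr0.
Qed.

Lemma deriv_along_comp (F : R -> R) f f' F' : deriv_along f f' ->
  (forall p, is_derive (f p) 1 F (F' p)) ->
  deriv_along (fun p => F (f p)) (fun p => F' p * f' p).
Proof.
move=> ff FF xi y.
apply: (@is_derive1_comp _ F (fun h => f (xi + h *: theta, y))) => //.
by rewrite scale0r addr0.
Qed.

Lemma deriv_alongV f f' : (forall p, f p != 0) -> deriv_along f f' ->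
  deriv_along (fun p => (f p)^-1) (fun p => - ((f p)^-1 * (f p)^-1 * f' p)).
Proof.
move=> f0 ff xi y; apply: is_derive_eq; first exact: is_deriveV.
by rewrite /= scale0r addr0 /GRing.scale/= expr2 invfM mulNr.
Qed.

Lemma deriv_along_snd (c : Y -> R) :
  deriv_along (fun p => c p.2) (fun=> 0).
Proof. by move=> xi y /=; exact: is_derive_cst. Qed.

Lemma deriv_along_linear (v : 'rV[R]_d) :
  deriv_along (fun p => dotp v p.1) (fun=> dotp v theta).
Proof.
move=> xi y /=.
rewrite (_ : (fun _ => _) = fun h : R => dotp v xi + dotp v theta * h).
  by apply: is_derive_eq; rewrite /GRing.scale/=; ring.
by apply/funext => h; rewrite dotpDr dotpZr mulrC.
Qed.

Lemma deriv_along_sqr :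
  deriv_along (fun p => dotp p.1 p.1) (fun p => 2 * dotp theta p.1).
Proof.
move=> xi y /=.
rewrite (_ : (fun _ => _) = fun h : R => dotp xi xi + (2 * dotp theta xi) * h
   + dotp theta theta * h ^+ 2).
  apply: is_derive_eq; rewrite /GRing.scale/=; ring.
by apply/funext => h; rewrite dotp_sqrD !dotpZr !dotpZl [dotp xi theta]dotpC; ring.
Qed.

Lemma symbol_base B k f : symbol B k f -> B f.
Proof. by case: k => [|k] []. Qed.

Lemma symbolW B k f : symbol B k.+1 f -> symbol B k f.
Proof.
elim: k f => [|k IH] f; first by case.
by case=> Bf [f' ff' sf']; split=> //; exists f' => //; apply: IH.
Qed.

Lemma symbolD B k f g :
  (forall f g, B f -> B g -> B (fun p => f p + g p)) ->
  symbol B k f -> symbol B k g -> symbol B k (fun p => f p + g p).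
Proof.
move=> BD; elim: k f g => [|k IH] f g [Bf sf] [Bg sg]; split => //; try exact: BD.
have [f' ff' sf'] := sf; have [g' gg' sg'] := sg.
by exists (fun p => f' p + g' p); [exact: deriv_alongD|exact: IH].
Qed.

Lemma symbolN B k f : (forall f, B f -> B (fun p => - f p)) ->
  symbol B k f -> symbol B k (fun p => - f p).
Proof.
move=> BN; elim: k f => [|k IH] f [Bf sf]; split => //; try exact: BN.
have [f' ff' sf'] := sf.
by exists (fun p => - f' p); [exact: deriv_alongN|exact: IH].
Qed.

(** Two classes are kept apart so that one Leibniz induction makes tempered symbols an algebra and
    rapid symbols a module over it. *)
Lemma symbolM B1 B2 k f g :
  (forall f g, B2 f -> B2 g -> B2 (fun p => f p + g p)) ->
  (forall f g, B1 f -> B2 g -> B2 (fun p => f p * g p)) ->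
  symbol B1 k f -> symbol B2 k g -> symbol B2 k (fun p => f p * g p).
Proof.
move=> BD BM; elim: k f g => [|k IH] f g [Bf sf] [Bg sg]; split => //; try exact: BM.
have [f' ff' sf'] := sf; have [g' gg' sg'] := sg.
have skf : symbol B1 k f by apply: symbolW; split.
have skg : symbol B2 k g by apply: symbolW; split.
exists (fun p => f p * g' p + g p * f' p); first exact: deriv_alongM.
apply: symbolD => //; first exact: IH.
by rewrite (_ : (fun _ => _) = fun p => f' p * g p);
  [exact: IH|apply/funext => p; rewrite mulrC].
Qed.

Lemma tempered_bound f : tempered f ->
  exists C N, 0 <= C /\ forall p, `|f p| <= C * weight p.1 ^+ N.
Proof.
move=> [_ [C [N fC]]]; exists `|C|, N; split => // p.
by apply: le_trans (fC p) _; rewrite ler_wpM2r ?ler_norm ?ltW ?weightX_gt0.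
Qed.

Lemma temperedD f g : tempered f -> tempered g -> tempered (fun p => f p + g p).
Proof.
move=> tf tg; split.
  by apply: measurable_funD; [case: tf|case: tg].
have [C [N [C0 fC]]] := tempered_bound tf.
have [D [M [D0 gD]]] := tempered_bound tg.
exists (C + D), (N + M)%N => p; apply: le_trans (ler_normD _ _) _.
rewrite mulrDl lerD//.
  apply: le_trans (fC p) _; rewrite ler_wpM2l// exprD ler_peMr//.
    by rewrite ltW ?weightX_gt0.
  exact: weightXr_ge1.
apply: le_trans (gD p) _; rewrite ler_wpM2l// exprD ler_peMl//.
  by rewrite ltW ?weightX_gt0.
exact: weightXr_ge1.
Qed.

Lemma temperedN f : tempered f -> tempered (fun p => - f p).
Proof.
move=> [mf [C [N fC]]]; split; first exact: measurableT_comp.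
by exists C, N => p; rewrite normrN.
Qed.

Lemma temperedM f g : tempered f -> tempered g -> tempered (fun p => f p * g p).
Proof.
move=> tf tg; split.
  by apply: measurable_funM; [case: tf|case: tg].
have [C [N [C0 fC]]] := tempered_bound tf.
have [D [M [D0 gD]]] := tempered_bound tg.
exists (C * D), (N + M)%N => p.
by rewrite normrM exprD mulrACA ler_pM.
Qed.

Lemma rapidD f g : rapid f -> rapid g -> rapid (fun p => f p + g p).
Proof.
move=> [mf rf] [mg rg]; split; first exact: measurable_funD.
move=> N; have [C fC] := rf N; have [D gD] := rg N; exists (C + D) => p.
apply: le_trans (lerD (fC p) (gD p)).
by rewrite -mulrDr ler_wpM2l ?ler_normD// ltW ?weightX_gt0.
Qed.

Lemma rapidN f : rapid f -> rapid (fun p => - f p).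
Proof.
move=> [mf rf]; split; first exact: measurableT_comp.
by move=> N; have [C fC] := rf N; exists C => p; rewrite normrN.
Qed.

Lemma rapidMl f g : tempered f -> rapid g -> rapid (fun p => f p * g p).
Proof.
move=> tf [mg rg]; split.
  by apply: measurable_funM => //; case: tf.
have [C [N [C0 fC]]] := tempered_bound tf.
move=> M; have [D gD] := rg (M + N)%N; exists (C * D) => p.
apply: le_trans (_ : C * (weight p.1 ^+ (M + N) * `|g p|) <= _); last first.
  by rewrite ler_wpM2l.
rewrite normrM exprD.
rewrite [leRHS](_ : _ = weight p.1 ^+ M * (C * weight p.1 ^+ N * `|g p|)).
  by rewrite ler_wpM2l ?ler_wpM2r// ltW// weightX_gt0.
by ring.
Qed.

Definition smooth_tempered f := forall k, symbol tempered k f.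
Definition smooth_rapid f := forall k, symbol rapid k f.

Lemma smooth_tempered_snd (c : Y -> R) C : measurable_fun setT c ->
  (forall y, `|c y| <= C) -> smooth_tempered (fun p => c p.2).
Proof.
move=> mc cC k.
have zero j : symbol tempered j (fun=> 0).
  elim: j => [|j IH]; split => //; last first.
  - by exists (fun=> 0) => //; exact: (deriv_along_snd (fun=> 0)).
  - by split => //; exists 0, 0%N => p; rewrite normr0 mul0r.
  - by split => //; exists 0, 0%N => p; rewrite normr0 mul0r.
have Bc : tempered (fun p => c p.2).
  split; first exact: (measurableT_comp mc).
  by exists C, 0%N => p; rewrite expr0 mulr1.
case: k => [|k]; split => //.
by exists (fun=> 0) => //; exact: deriv_along_snd.
Qed.

Lemma smooth_tempered_cst (c : R) : smooth_tempered (fun=> c).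
Proof. exact: (@smooth_tempered_snd (fun=> c) `|c|). Qed.

Lemma measurable_dotpr (v : 'rV[R]_d) :
  measurable_fun setT (fun p : 'rV[R]_d * Y => dotp v p.1).
Proof.
apply: measurable_sum => i; apply: measurable_funM => //.
by apply: (measurableT_comp (@measurable_rV_coord R d i)).
Qed.

Lemma symbol_temperedM k f g : symbol tempered k f -> symbol tempered k g ->
  symbol tempered k (fun p => f p * g p).
Proof. by apply: symbolM; [exact: temperedD|exact: temperedM]. Qed.

Lemma smooth_temperedD f g : smooth_tempered f -> smooth_tempered g ->
  smooth_tempered (fun p => f p + g p).
Proof. by move=> sf sg k; apply: symbolD => //; exact: temperedD. Qed.

Lemma smooth_temperedN f : smooth_tempered f ->
  smooth_tempered (fun p => - f p).
Proof. by move=> sf k; apply: symbolN => //; exact: temperedN. Qed.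

Lemma smooth_temperedM f g : smooth_tempered f -> smooth_tempered g ->
  smooth_tempered (fun p => f p * g p).
Proof. by move=> sf sg k; exact: symbol_temperedM. Qed.

Lemma smooth_rapidD f g : smooth_rapid f -> smooth_rapid g ->
  smooth_rapid (fun p => f p + g p).
Proof. by move=> sf sg k; apply: symbolD => //; exact: rapidD. Qed.

Lemma smooth_rapidN f : smooth_rapid f -> smooth_rapid (fun p => - f p).
Proof. by move=> sf k; apply: symbolN => //; exact: rapidN. Qed.

Lemma symbol_rapidMl k f g : smooth_tempered f -> symbol rapid k g ->
  symbol rapid k (fun p => f p * g p).
Proof.
move=> sf sg.
by apply: (symbolM _ _ (sf k)) => //; [exact: rapidD|exact: rapidMl].
Qed.

Lemma smooth_rapidMl f g : smooth_tempered f -> smooth_rapid g ->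
  smooth_rapid (fun p => f p * g p).
Proof. by move=> sf sg k; exact: symbol_rapidMl. Qed.

(** If [f'] is a polynomial in [f] and smooth symbols, then the bound for [f]
    alone makes [f] a smooth symbol, by induction on the order. *)
Lemma smooth_tempered_ode f f' : tempered f -> deriv_along f f' ->
  (forall k, symbol tempered k f -> symbol tempered k f') ->
  smooth_tempered f.
Proof.
move=> tf ff' ode; elim=> [|k IH]; split=> //.
by exists f' => //; exact: ode.
Qed.

Lemma deriv_along_uniq f f1 f2 : deriv_along f f1 -> deriv_along f f2 -> f1 = f2.
Proof.
move=> d1 d2; apply/funext => -[xi y].
by have [_ <-] := d1 xi y; have [_ <-] := d2 xi y.
Qed.

(** Each order [k] comes with its own witness for the derivative; uniqueness identifies them, so
    that one function serves all orders. *)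
Lemma smooth_deriv_along B f : (forall k, symbol B k f) ->
  exists2 f', deriv_along f f' & forall k, symbol B k f'.
Proof.
move=> sf; have [_ [f' ff' _]] := sf 1%N; exists f' => // k.
by have [_ [f'' /(deriv_along_uniq ff') <-]] := sf k.+1.
Qed.

Hypothesis theta1 : dotp theta theta = 1.

Lemma smooth_tempered_linear :
  smooth_tempered (fun p => dotp theta p.1).
Proof.
move=> k; apply: (smooth_tempered_ode _ (deriv_along_linear theta)) => //.
  split; first exact: measurable_dotpr.
  exists 1, 1%N => p; rewrite mul1r expr1.
  have := unit_cauchy_schwarz p.1 theta1.
  rewrite -(real_normK (num_real (dotp theta p.1))) /weight.
  (* The square gives [u <= u^2 + 1/4], and [u^2] is at most [|xi|^2]. *)
  move: `|_| => u uD; have := sqr_ge0 (u - 2^-1); nra.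
by move=> j _; apply: smooth_tempered_cst.
Qed.

Lemma smooth_tempered_trig (q : R) :
  smooth_tempered (fun p => cos (q * dotp theta p.1)) /\
  smooth_tempered (fun p => sin (q * dotp theta p.1)).
Proof.
have dl : deriv_along (fun p => q * dotp theta p.1) (fun=> q).
  have := deriv_alongM (deriv_along_snd (fun=> q)) (deriv_along_linear theta).
  by rewrite theta1; under [X in deriv_along _ X]funext do
    rewrite mulr1 mulr0 addr0.
have dcos := deriv_along_comp dl (fun p => is_derive_cos (q * dotp theta p.1)).
have dsin := deriv_along_comp dl (fun p => is_derive_sin (q * dotp theta p.1)).
have ml : measurable_fun [set: 'rV[R]_d * Y] (fun p => q * dotp theta p.1).
  by apply: measurable_funM => //; exact: measurable_dotpr.
have tcos : tempered (fun p => cos (q * dotp theta p.1)).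
  split; first exact: (measurableT_comp (@measurable_cos R) ml).
  by exists 1, 0%N => p; rewrite mul1r expr0 ler_norml cos_geN1 cos_le1.
have tsin : tempered (fun p => sin (q * dotp theta p.1)).
  split; first exact: (measurableT_comp (@measurable_sin R) ml).
  by exists 1, 0%N => p; rewrite mul1r expr0 ler_norml sin_geN1 sin_le1.
(* Each function is, up to a constant factor, the derivative of the other, so the induction must
   carry both. *)
suff trig k : symbol tempered k (fun p => cos (q * dotp theta p.1)) /\
    symbol tempered k (fun p => sin (q * dotp theta p.1)).
  by split=> k; have [] := trig k.
elim: k => [|k [IHc IHs]]; first by [].
split; split=> //.
  exists (fun p => - sin (q * dotp theta p.1) * q); first exact: dcos.
  apply: (@symbol_temperedM k _ (fun=> q)).
    by apply: symbolN => //; exact: temperedN.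
  exact: smooth_tempered_cst.
exists (fun p => cos (q * dotp theta p.1) * q); first exact: dsin.
apply: (@symbol_temperedM k _ (fun=> q)) => //.
exact: smooth_tempered_cst.
Qed.

End symbols.

(** * The phase and the reciprocal of its slope *)

Section phase.
Variables (R : realType) (d : nat) (dY : measure_display) (Y : measurableType dY).
Variables (theta : 'rV[R]_d) (m : R) (c : Y -> R).
Hypothesis theta1 : dotp theta theta = 1.
Hypothesis m0 : 0 < m.
Hypothesis mc : measurable_fun setT c.
Hypothesis c1 : forall y, `|c y| <= 1.
Implicit Types p : 'rV[R]_d * Y.

Lemma energy_sqr (xi : 'rV[R]_d) : energy m xi ^+ 2 = dotp xi xi + m ^+ 2.
Proof. by rewrite sqr_sqrtr// addr_ge0 ?dotp_ge0 ?sqr_ge0. Qed.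

Lemma energy_ge (xi : 'rV[R]_d) : m <= energy m xi.
Proof.
have e0 : 0 <= energy m xi by exact: sqrtr_ge0.
rewrite -(@ler_pXn2r _ 2)// ?nnegrE ?(ltW m0)//.
by rewrite energy_sqr lerDr dotp_ge0.
Qed.

Lemma energy_gt0 (xi : 'rV[R]_d) : 0 < energy m xi.
Proof. exact: lt_le_trans (energy_ge xi). Qed.

Lemma measurable_energy :
  measurable_fun [set: 'rV[R]_d * Y] (fun p => energy m p.1).
Proof.
apply: (measurableT_comp (@measurable_sqrt R)).
apply: measurable_funD => //.
exact: (measurableT_comp (@measurable_dotp R d) (measurable_fst)).
Qed.

Lemma deriv_along_energy : deriv_along theta (fun p => energy m p.1)
  (fun p => dotp theta p.1 / energy m p.1).
Proof.
have := deriv_alongD (@deriv_along_sqr _ _ _ Y theta)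
  (deriv_along_snd theta (fun=> m ^+ 2)).
move=> /(@deriv_along_comp _ _ _ _ _ Num.sqrt) h.
rewrite (_ : (fun p => dotp theta p.1 / energy m p.1) = fun p =>
    (2 * energy m p.1)^-1 * (2 * dotp theta p.1 + 0)).
  apply: h => p; apply: is_derive1_sqrt.
  by rewrite ltr_wpDl ?dotp_ge0 ?exprn_gt0.
apply/funext => p; have := energy_gt0 p.1 => e0.
by field; rewrite gt_eqF.
Qed.

(** The derivative of [1/E] is [- l / E^3], a polynomial in [1/E] and the linear form [l], so
    [smooth_tempered_ode] applies. The bound [1/E <= 1/m] uses [m > 0]. *)
Lemma smooth_tempered_energyV :
  smooth_tempered theta (fun p => (energy m p.1)^-1).
Proof.
have e0 p : energy m p.1 != 0 by rewrite gt_eqF ?energy_gt0.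
have dE := deriv_alongV e0 deriv_along_energy.
apply: (smooth_tempered_ode _ dE) => [|k sE].
  split; first by apply: measurable_invr_gt0 => [p|];
    [exact: energy_gt0|exact: measurable_energy].
  exists m^-1, 0%N => p; rewrite expr0 mulr1 gtr0_norm ?invr_gt0 ?energy_gt0//.
  by rewrite lef_pV2 ?posrE ?energy_gt0// energy_ge.
apply: symbolN; first exact: temperedN.
apply: symbol_temperedM; first exact: symbol_temperedM.
by apply: symbol_temperedM => //; exact: smooth_tempered_linear.
Qed.

Definition phase p : R := dotp theta p.1 - c p.2 * energy m p.1.

Definition phase_slope p : R := 1 - c p.2 * (dotp theta p.1 / energy m p.1).

Lemma deriv_along_phase : deriv_along theta phase phase_slope.
Proof.
have := deriv_alongN (deriv_alongM (deriv_along_snd theta c) deriv_along_energy).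
move=> /(deriv_alongD (deriv_along_linear theta theta)).
rewrite theta1; under [X in deriv_along _ _ X]funext do rewrite mulr0 addr0.
by [].
Qed.

Lemma measurable_phase : measurable_fun [set: 'rV[R]_d * Y] phase.
Proof.
apply: measurable_funB; first exact: measurable_dotpr.
by apply: measurable_funM; [exact: measurableT_comp|exact: measurable_energy].
Qed.

Lemma smooth_tempered_phase_slope : smooth_tempered theta phase_slope.
Proof.
apply: smooth_temperedD; first exact: smooth_tempered_cst.
apply: smooth_temperedN; apply: smooth_temperedM.
  exact: smooth_tempered_snd c1.
by apply: smooth_temperedM; [exact: smooth_tempered_linear|
  exact: smooth_tempered_energyV].
Qed.

(** The phase has no critical point because [|xi| < energy m xi]. *)
Lemma phase_slope_ge p : m ^+ 2 / (2 * energy m p.1 ^+ 2) <= phase_slope p.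
Proof.
have e0 := energy_gt0 p.1.
have := unit_cauchy_schwarz p.1 theta1.
have := c1 p.2; rewrite ler_norml => /andP[c1l c1r].
have := energy_sqr p.1; rewrite /phase_slope.
have : m ^+ 2 <= energy m p.1 ^+ 2 by rewrite energy_sqr lerDr dotp_ge0.
move: (c p.2) (dotp theta p.1) (dotp p.1 p.1) (energy m p.1) e0 c1l c1r.
move=> a l D e e0 a1 a2 me eD lD.
have {}lD : l ^+ 2 <= e ^+ 2 - m ^+ 2 by rewrite eD addrK.
rewrite -subr_ge0.
have -> : 1 - a * (l / e) - m ^+ 2 / (2 * e ^+ 2) =
    (2 * e ^+ 2 - 2 * (a * l) * e - m ^+ 2) / (2 * e ^+ 2).
  by field; rewrite gt_eqF.
apply: divr_ge0; last by rewrite mulr_ge0// exprn_ge0// ltW.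
have al : (a * l) ^+ 2 <= l ^+ 2.
  by rewrite exprMn ler_piMl ?sqr_ge0// -(real_normK (num_real a)) exprn_ile1//
    ler_norml a1.
(* The square gives [2 a l e <= e^2 + (a l)^2 <= e^2 + l^2 <= 2 e^2 - m^2], which is the
   nonnegativity of the numerator. *)
have := sqr_ge0 (e - a * l); nra.
Qed.

Lemma phase_slope_gt0 p : 0 < phase_slope p.
Proof.
apply: lt_le_trans (phase_slope_ge p).
by rewrite divr_gt0 ?mulr_gt0 ?exprn_gt0 ?energy_gt0.
Qed.

(** The reciprocal [1/g] of the slope has derivative [- g' / g^2], a polynomial in [1/g] with the
    smooth symbol [g'] as coefficient. The lower bound on the slope gives [1/g <= 2 E^2 / m^2],
    which is of order one in the weight. *)
Lemma smooth_tempered_phase_slopeV :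
  smooth_tempered theta (fun p => (phase_slope p)^-1).
Proof.
have [g' gg' sg'] := smooth_deriv_along smooth_tempered_phase_slope.
have g0 p : phase_slope p != 0 by rewrite gt_eqF ?phase_slope_gt0.
have dg := deriv_alongV g0 gg'.
apply: (smooth_tempered_ode _ dg) => [|k sg].
  split.
    apply: measurable_invr_gt0; first exact: phase_slope_gt0.
    by have [] := symbol_base (smooth_tempered_phase_slope 0).
  exists (2 * (1 + m ^- 2)), 1%N => p; rewrite expr1.
  rewrite gtr0_norm ?invr_gt0 ?phase_slope_gt0//.
  apply: (@le_trans _ _ (m ^+ 2 / (2 * energy m p.1 ^+ 2))^-1).
    by rewrite lef_pV2 ?posrE ?phase_slope_gt0 ?phase_slope_ge//
      divr_gt0 ?mulr_gt0 ?exprn_gt0 ?energy_gt0.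
  rewrite invf_div energy_sqr /weight -subr_ge0.
  move: (dotp p.1 p.1) (dotp_ge0 p.1) => D D0.
  rewrite (_ : _ - _ = 2 * (D + m ^- 2)); last by field; rewrite gt_eqF.
  by rewrite mulr_ge0// addr_ge0// invr_ge0 sqr_ge0.
apply: symbolN; first exact: temperedN.
by apply: symbol_temperedM => //; exact: symbol_temperedM.
Qed.

End phase.

(** * Translation invariance of Lebesgue measure on row vectors *)

Section measure_preserving.
Local Open Scope ereal_scope.

Definition measure_preserving (R : realType) (dT : measure_display)
    (T : measurableType dT) (mu : set T -> \bar R) (f : T -> T) :=
  measurable_fun setT f /\
  forall A, measurable A -> mu (f @^-1` A) = mu A.

Lemma measurable_preimage (dS dT : measure_display) (S : measurableType dS)
    (T : measurableType dT) (f : S -> T) A :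
  measurable_fun setT f -> measurable A -> measurable (f @^-1` A).
Proof. by move=> mf mA; rewrite -[X in measurable X]setTI; exact: mf. Qed.

(** The pushforward of the product measure agrees with the product measure on rectangles, and these
    determine it. *)
Lemma product_measure_preserving (R : realType) (d1 d2 : measure_display)
    (T1 : measurableType d1) (T2 : measurableType d2)
    (m1 : {sigma_finite_measure set T1 -> \bar R})
    (m2 : {sigma_finite_measure set T2 -> \bar R}) (f : T1 -> T1) (g : T2 -> T2) :
  measure_preserving m1 f -> measure_preserving m2 g ->
  measure_preserving (m1 \x m2) (fun p => (f p.1, g p.2)).
Proof.
move=> [mf pf] [mg pg].
have mfg : measurable_fun [set: T1 * T2] (fun p => (f p.1, g p.2)).
  by apply: measurable_fun_pair; apply: measurableT_comp.
split=> // A mA.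
have h := @product_measure_unique _ _ _ _ R m1 m2
  (measure_function_pushforward__canonical__measure_function_Measure (m1 \x m2) mfg).
rewrite [RHS]h// => B C mB mC; rewrite /= /pushforward.
have -> : (fun p => (f p.1, g p.2)) @^-1` (B `*` C) =
   (f @^-1` B) `*` (g @^-1` C) by [].
rewrite product_measure1E; [|exact: measurable_preimage..].
by congr (_ * _); [exact: pf|exact: pg].
Qed.

Lemma lebesgue_measure_translate (R : realType) (a : R) :
  measure_preserving (@lebesgue_measure R) (fun x : measurableTypeR R => x + a)%R.
Proof.
have mf : measurable_fun [set: measurableTypeR R]
    (fun x => (x + a)%R : measurableTypeR R).
  exact: measurable_funD.
split=> // A mA.
have h := @lebesgue_measure_unique R
  (measure_function_pushforward__canonical__measure_function_Measure
     (@lebesgue_measure R) mf).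
rewrite [RHS]h// => _ [[u v] _ <-]; rewrite /= /pushforward.
rewrite (_ : _ @^-1` _ = `]u - a, v - a]%classic%R).
  rewrite !lebesgue_measure_itv/= !lte_fin ltrD2r.
  by case: ifP => // _; rewrite -!EFinD; congr (_%:E); ring.
by apply/seteqP; split=> x/=; rewrite !in_itv/= ltrBlDr lerBrDr.
Qed.

(** Splitting off the first coordinate by [leb_cons] turns a translation into a product of
    translations, one on the line and one in dimension [d]. *)
Lemma leb_translate (R : realType) (d : nat) (v : 'rV[R]_d) :
  measure_preserving (leb R d) (fun x => x + v)%R.
Proof.
elim: d v => [|d IH] v.
  split; first by apply/measurable_fun_rVP => -[].
  move=> A mA; congr (leb R 0 _); apply/seteqP.
  by split=> x; rewrite /= [(x + v)%R]thinmx0 [x]thinmx0.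
split.
  apply/measurable_fun_rVP => i.
    rewrite (_ : _ \o _ = fun x : 'rV[R]_d.+1 => (x 0 i + v 0 i)%R).
    by apply: measurable_funD => //; exact: (@measurable_rV_coord R d.+1 i).
  by apply/funext => x; rewrite /= /rV_coord mxE.
move=> A mA; rewrite /= /leb_step /pushforward.
have [_ pres] := product_measure_preserving
  (lebesgue_measure_translate (v 0%R ord0)) (IH (\row_k v 0%R (lift ord0 k))).
have mA' := measurable_preimage (@measurable_leb_cons R d) mA.
have {pres}pres := pres _ mA'.
apply: etrans pres.
have consD : (fun x => x + v)%R \o @leb_cons R d = @leb_cons R d \o
    (fun p => (p.1 + v 0 ord0, p.2 + \row_k v 0 (lift ord0 k)))%R.
  apply/funext => -[x y]; apply/rowP => i.
  by rewrite !mxE; case: unliftP => [j|] ->; rewrite ?mxE.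
suff -> : @leb_cons R d @^-1` ((fun x => x + v)%R @^-1` A) =
    (fun p => (p.1 + v 0 ord0, p.2 + \row_k v 0 (lift ord0 k)))%R @^-1`
    (@leb_cons R d @^-1` A) by [].
transitivity (((fun x => x + v)%R \o @leb_cons R d) @^-1` A); first by [].
by rewrite consD.
Qed.

Lemma measure_preserving_id (R : realType) (dT : measure_display)
    (T : measurableType dT) (mu : set T -> \bar R) : measure_preserving mu id.
Proof. by split. Qed.

Lemma measure_preserving_integral (R : realType) (dT : measure_display)
    (T : measurableType dT) (mu : {measure set T -> \bar R}) (f : T -> T)
    (g : T -> R) :
  measure_preserving mu f -> mu.-integrable setT (EFin \o g) ->
  mu.-integrable setT (EFin \o (g \o f)) /\
  \int[mu]_x (g (f x))%:E = \int[mu]_x (g x)%:E.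
Proof.
move=> [mf pf] ig.
have mg : measurable_fun setT (EFin \o g) by case/integrableP : ig.
have igf : mu.-integrable setT (EFin \o (g \o f)).
  apply/integrableP; split.
    by apply/measurable_EFinP; apply: measurableT_comp => //; exact/measurable_EFinP.
  case/integrableP : ig => _; apply: le_lt_trans.
  rewrite [leRHS](@eq_measure_integral _ _ _ _ (pushforward mu f)).
    rewrite (@ge0_integral_pushforward _ _ _ _ _ _ mf)//.
    exact: measurableT_comp.
  by move=> A mA _; exact/esym/pf.
split=> //.
rewrite [RHS](@eq_measure_integral _ _ _ _ (pushforward mu f)).
  by rewrite (@integral_pushforward _ _ _ _ _ _ mf).
by move=> A mA _; exact/esym/pf.
Qed.

End measure_preserving.

(** * Integrability of a negative power of the weight *)

Section weight_integrable.
Variable R : realType.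
Local Open Scope ereal_scope.

Lemma integral_oneDsqr_lty :
  \int[@lebesgue_measure R]_x ((oneDsqr x)^-1)%:E < +oo.
Proof.
rewrite ge0_symfun_integralT.
- by rewrite -set_itvcy integral0y_oneDsqr -EFinM ltry.
- by move=> x; rewrite invr_ge0; apply: le_trans (oneDsqr_ge1 _).
- exact: continuous_oneDsqrV.
- by move=> x; rewrite /= /oneDsqr/= sqrrN.
Qed.

Lemma measurable_weightX (d N : nat) :
  measurable_fun setT (fun x : 'rV[R]_d => weight x ^+ N)%R.
Proof.
by apply: measurable_funX; apply: measurable_funD => //; exact: measurable_dotp.
Qed.

Lemma measurable_weightXV (d N : nat) :
  measurable_fun setT (fun x : 'rV[R]_d => (weight x ^+ N)^-1)%R.
Proof.
apply: measurable_invr_gt0; first by move=> x; exact: weightX_gt0.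
exact: measurable_weightX.
Qed.

(** For [x = (t, y)] the weight dominates both [1 + t^2] and [1 + |y|^2]. One of its [d + 1] factors
    is spent on [t] and the others on [y], so the integral is bounded by a product to which the
    induction hypothesis applies. *)
Lemma weightV_integral_lty (d : nat) :
  \int[leb R d]_x ((weight x ^+ d)^-1)%:E < +oo.
Proof.
elim: d => [|d IH].
  under eq_integral => x _ do rewrite expr0 invr1.
  by rewrite integral_cst//= diracE mem_set// mule1 ltry.
rewrite /= /leb_step.
rewrite (ge0_integral_pushforward (@measurable_leb_cons R d))//; first last.
  by move=> x _; rewrite lee_fin invr_ge0 ltW// weightX_gt0.
  by apply/measurable_EFinP; exact: measurable_weightXV.
rewrite preimage_setT.
have oneD (x : R) : (0 < oneDsqr x)%R by exact: lt_le_trans (oneDsqr_ge1 x).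
have m1 : measurable_fun [set: measurableTypeR R] (fun x => (oneDsqr x)^-1)%R.
  apply: continuous_measurable_fun; exact: continuous_oneDsqrV.
have m2 := @measurable_weightXV d d.
have mf : measurable_fun [set: measurableTypeR R * 'rV[R]_d]
    (fun z => ((oneDsqr z.1)^-1 * (weight z.2 ^+ d)^-1)%:E).
  apply/measurable_EFinP; apply: measurable_funM.
    exact: (measurableT_comp m1 measurable_fst).
  exact: (measurableT_comp m2 measurable_snd).
apply: (@le_lt_trans _ _ (\int[lebesgue_measure \x leb R d]_z
    ((oneDsqr z.1)^-1 * (weight z.2 ^+ d)^-1)%:E)).
  apply: ge0_le_integral => //.
  - by move=> x _; rewrite /= lee_fin invr_ge0 ltW// weightX_gt0.
  - apply: (measurableT_comp _ (@measurable_leb_cons R d)).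
    by apply/measurable_EFinP; exact: measurable_weightXV.
  move=> [x y] _; rewrite /= lee_fin -invfM.
  rewrite lef_pV2 ?posrE ?mulr_gt0 ?weightX_gt0//.
  have -> : weight (leb_cons (x, y)) = (oneDsqr x + dotp y y)%R.
    rewrite /weight /dotp big_ord_recl !mxE unlift_none /oneDsqr/= -addrA.
    congr (_ + (_ + _))%R; apply: eq_bigr => i _.
    by rewrite !mxE liftK.
  rewrite exprS; apply: ler_pM.
  - exact/ltW.
  - exact/ltW/weightX_gt0.
  - by rewrite lerDl dotp_ge0.
  have wy : (0 <= weight y)%R by exact/ltW/weight_gt0.
  have ox : (0 <= oneDsqr x + dotp y y)%R.
    by apply: addr_ge0; [exact/ltW|exact: dotp_ge0].
  rewrite lerXn2r ?nnegrE//.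
  by rewrite /weight lerD2r oneDsqr_ge1.
rewrite fubini_tonelli1//=; last first.
  by move=> x; rewrite lee_fin mulr_ge0// invr_ge0 ltW// weightX_gt0.
rewrite /fubini_F/=.
under eq_integral => x _.
  under eq_integral => y _ do rewrite EFinM.
  rewrite ge0_integralZl//; first last.
  - by move=> y _; rewrite lee_fin invr_ge0 ltW// weightX_gt0.
  - exact/measurable_EFinP.
  over.
have I0 : 0 <= \int[leb R d]_x ((weight x ^+ d)^-1)%:E.
  by apply: integral_ge0 => y _; rewrite lee_fin invr_ge0 ltW// weightX_gt0.
rewrite ge0_integralZr//; last exact/measurable_EFinP.
rewrite lte_mul_pinfty// ?integral_oneDsqr_lty//.
  by apply: integral_ge0 => y _; rewrite lee_fin invr_ge0 ltW.
rewrite ge0_fin_numE ?integral_oneDsqr_lty//.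
by apply: integral_ge0 => y _; rewrite lee_fin invr_ge0 ltW.
Qed.

End weight_integrable.

(** * Vanishing of the integral of a derivative along [theta] *)

Section directional_integration_by_parts.
Variables (R : realType) (d : nat) (dY : measure_display) (Y : measurableType dY).
Variable kappa : {sigma_finite_measure set Y -> \bar R}.
Hypothesis kappa_fin : (kappa setT < +oo)%E.
Variable theta : 'rV[R]_d.
Hypothesis theta1 : dotp theta theta = 1.
Local Notation nu := (leb R d \x kappa)%E.
Implicit Types f F : 'rV[R]_d * Y -> R.

Lemma weightV_integrable :
  nu.-integrable setT (EFin \o (fun p => (weight p.1 ^+ d)^-1)).
Proof.
have mw : measurable_fun setT (EFin \o (fun p : 'rV[R]_d * Y => (weight p.1 ^+ d)^-1)).
  apply/measurable_EFinP.
  exact: (measurableT_comp (@measurable_weightXV R d d) measurable_fst).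
apply/integrableP; split=> //.
have -> : (\int[nu]_p `|((weight p.1 ^+ d)^-1)%R%:E|)%E =
    (\int[nu]_p ((weight p.1 ^+ d)^-1)%R%:E)%E.
  apply: eq_integral => p _; rewrite /= ger0_norm// invr_ge0 ltW//.
  exact: weightX_gt0.
rewrite fubini_tonelli1//=; last first.
  by move=> p; rewrite lee_fin invr_ge0 ltW// weightX_gt0.
rewrite /fubini_F/=.
under eq_integral => x _ do rewrite integral_cst//.
rewrite ge0_integralZr//; last 2 first.
- by apply/measurable_EFinP; exact: measurable_weightXV.
- by move=> x _; rewrite lee_fin invr_ge0 ltW// weightX_gt0.
apply: lte_mul_pinfty => //.
  by apply: integral_ge0 => x _; rewrite lee_fin invr_ge0 ltW// weightX_gt0.
rewrite ge0_fin_numE ?weightV_integral_lty//.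
by apply: integral_ge0 => x _; rewrite lee_fin invr_ge0 ltW// weightX_gt0.
Qed.

Lemma rapid_le f : rapid f ->
  exists C, forall p, `|f p| <= C * (weight p.1 ^+ d)^-1.
Proof.
move=> [_ /(_ d)[C fC]]; exists C => p.
by rewrite ler_pdivlMr ?weightX_gt0// mulrC.
Qed.

Lemma rapid_integrable f : rapid f -> nu.-integrable setT (EFin \o f).
Proof.
move=> rf; have [C fC] := rapid_le rf; have [mf _] := rf.
apply: (@le_integrable _ _ _ nu setT measurableT _
  (EFin \o (fun p => C * (weight p.1 ^+ d)^-1))).
- exact/measurable_EFinP.
- by move=> p _; rewrite /= lee_fin (le_trans (fC p))// ler_norm.
rewrite (_ : _ \o _ = fun p => (C%:E * ((weight p.1 ^+ d)^-1)%:E)%E).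
  by apply: integrableZl => //; exact: weightV_integrable.
by apply/funext => p; rewrite /= EFinM.
Qed.

Lemma translate_measure_preserving (v : 'rV[R]_d) :
  measure_preserving nu (fun p => (p.1 + v, p.2)).
Proof.
exact: (product_measure_preserving (leb_translate v) (measure_preserving_id _)).
Qed.

Lemma deriv_along_line F F' xi y (h0 : R) : deriv_along theta F F' ->
  is_derive h0 1 (fun h : R => F (xi + h *: theta, y)) (F' (xi + h0 *: theta, y)).
Proof.
move=> dF.
have dS : is_derive h0 1 (fun h : R => h - h0) 1 by exact: is_derive_shift.
have dF0 : is_derive (h0 - h0) 1
    (fun k : R => F (xi + h0 *: theta + k *: theta, y)) (F' (xi + h0 *: theta, y)).
  by rewrite subrr; exact: dF.
have := @is_derive1_comp _ _ (fun h : R => h - h0) _ _ _ dF0 dS.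
rewrite mulr1 (_ : _ \o _ = fun h : R => F (xi + h *: theta, y))//.
by apply/funext => h /=; rewrite -addrA -scalerDl subrKC.
Qed.

Lemma deriv_along_seq F F' p : deriv_along theta F F' ->
  (fun n => (F (p.1 + n.+1%:R^-1 *: theta, p.2) - F p) * n.+1%:R) @ \oo --> F' p.
Proof.
case: p => xi y /= dF; have [dxi <-] := dF xi y.
have := dxi; rewrite /derivable => /cvg_ex[l Fl].
rewrite /derive (cvg_lim _ Fl)//.
have hu : (forall n, @harmonic R n != 0) /\ @harmonic R @ \oo --> (0 : R).
  by split=> [n|]; [rewrite /harmonic/= invr_eq0|exact: cvg_harmonic].
have := (cvgr_dnbhsP _ _ _).1 Fl _ hu.
apply: cvg_trans; apply: near_eq_cvg; near=> n.
rewrite /harmonic/= invrK scale0r !addr0 [_%:A]mulr1.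
by rewrite /GRing.scale/= mulrC.
Unshelve. all: by end_near. Qed.

(** By the mean value theorem the quotient is a value of [F'] at distance at most 1 from the base
    point; bringing the weight back to the base point costs 3 for each power. *)
Lemma deriv_along_le F F' C N : deriv_along theta F F' ->
  (forall p, `|F' p| <= C * (weight p.1 ^+ N)^-1) ->
  forall n p, `|(F (p.1 + n.+1%:R^-1 *: theta, p.2) - F p) * n.+1%:R|
    <= C * 3 ^+ N * (weight p.1 ^+ N)^-1.
Proof.
move=> dF FC n [xi y] /=.
have h0 : (0 : R) < n.+1%:R^-1 by rewrite invr_gt0 ltr0n.
have [|c /[!in_itv]/= /andP[c0 cn]] := @MVT _ (fun h : R => F (xi + h *: theta, y))
    (fun h => F' (xi + h *: theta, y)) _ _ h0
    (fun x _ => deriv_along_line xi y x dF).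
  apply: continuous_subspaceT => x.
  apply: differentiable_continuous; apply/derivable1_diffP.
  by have [] := deriv_along_line xi y x dF.
rewrite scale0r addr0 subr0 => ->; rewrite mulfVK ?pnatr_eq0//.
apply: le_trans (FC _) _; rewrite /= -mulrA.
have C0 : 0 <= C.
  have := le_trans (normr_ge0 _) (FC (xi, y)).
  by rewrite pmulr_lge0// invr_gt0 weightX_gt0.
apply: ler_wpM2l => //.
rewrite -[3 ^+ N]invrK -invfM.
rewrite lef_pV2 ?posrE ?weightX_gt0 ?mulr_gt0 ?invr_gt0 ?exprn_gt0//;
  last exact: weight_gt0.
rewrite mulrC ler_pdivrMr ?exprn_gt0// -exprMn_comm; last exact: mulrC.
have c1 : c <= 1 by apply: le_trans (ltW cn) _; rewrite invf_le1 ?ler1n ?ltr0n.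
have w0 (x : 'rV[R]_d) : 0 <= weight x by exact/ltW/weight_gt0.
rewrite lerXn2r ?nnegrE ?mulr_ge0// mulrC weight_translate//.
by rewrite dotpZl dotpZr theta1 mulr1 -expr2 exprn_ile1// ltW.
Qed.

(** By translation invariance the difference quotients have integral zero. *)
Lemma integral_deriv_along F F' : rapid F -> rapid F' ->
  deriv_along theta F F' -> \int[nu]_p F' p = 0.
Proof.
move=> rF rF' dF.
pose q n (p : 'rV[R]_d * Y) := (F (p.1 + n.+1%:R^-1 *: theta, p.2) - F p) * n.+1%:R.
have iF := rapid_integrable rF.
have iq n : nu.-integrable setT (EFin \o q n) /\ (\int[nu]_p (q n p)%:E = 0)%E.
  have [iFt eFt] := measure_preserving_integral
    (translate_measure_preserving (n.+1%:R^-1 *: theta)) iF.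
  have iB := integrableB measurableT iFt iF.
  have qE : EFin \o q n = (fun p => ((F (p.1 + n.+1%:R^-1 *: theta, p.2))%:E
      - (F p)%:E) * n.+1%:R%:E)%E.
    by apply/funext => p; rewrite /q/= EFinM EFinB.
  split; first by rewrite qE; exact: integrableZr iB.
  rewrite -[X in (integral _ _ X)]/(EFin \o q n) qE.
  rewrite integralZr//.
  rewrite integralB//= eFt subee ?mul0e//.
  exact: integrable_fin_num.
(* A bound on [F'] by the integrable power of the weight becomes a majorant common to all quotients,
   so dominated convergence applies. *)
have [C F'C] := rapid_le rF'.
have dom := deriv_along_le dF F'C.
have := @dominated_convergence _ _ _ nu setT measurableT (fun n => EFin \o q n)
  (EFin \o F') (EFin \o (fun p => C * 3 ^+ d * (weight p.1 ^+ d)^-1)).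
case.
- by move=> n; case/integrableP : (iq n).1.
- by apply/measurable_EFinP; case: rF'.
- apply: aeW => p _; apply/fine_cvgP; split; first exact: nearW.
  exact: deriv_along_seq dF.
- rewrite (_ : _ \o _ = fun p => ((C * 3 ^+ d)%:E * ((weight p.1 ^+ d)^-1)%:E)%E).
    by apply: integrableZl => //; exact: weightV_integrable.
  by apply/funext => p; rewrite /= EFinM.
- by apply: aeW => p n _; rewrite /= lee_fin; exact: dom.
move=> _ _ lim.
rewrite /Rintegral -(cvg_lim _ lim)//.
under eq_fun do rewrite /= (iq _).2.
by rewrite lim_cst.
Qed.

End directional_integration_by_parts.

(** * Decay of oscillatory integrals by repeated integration by parts *)

Section oscillatory_integral.
Variables (R : realType) (d : nat) (dY : measure_display) (Y : measurableType dY).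
Variable kappa : {sigma_finite_measure set Y -> \bar R}.
Hypothesis kappa_fin : (kappa setT < +oo)%E.
Variables (theta : 'rV[R]_d) (m : R) (c : Y -> R).
Hypothesis theta1 : dotp theta theta = 1.
Hypothesis m0 : 0 < m.
Hypothesis mc : measurable_fun setT c.
Hypothesis c1 : forall y, `|c y| <= 1.
Local Notation nu := (leb R d \x kappa)%E.
Local Notation phi := (phase theta m c).
Local Notation slope := (phase_slope theta m c).
Implicit Types f : 'rV[R]_d * Y -> R.

Lemma tempered_cos_phase s : tempered (fun p => cos (s * phi p)).
Proof.
have mp : measurable_fun setT (fun p => s * phi p).
  by apply: measurable_funM => //; exact: measurable_phase.
split; first exact: (measurableT_comp (@measurable_cos R) mp).
by exists 1, 0%N => p; rewrite mul1r expr0 ler_norml cos_geN1 cos_le1.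
Qed.

Lemma tempered_sin_phase s : tempered (fun p => sin (s * phi p)).
Proof.
have mp : measurable_fun setT (fun p => s * phi p).
  by apply: measurable_funM => //; exact: measurable_phase.
split; first exact: (measurableT_comp (@measurable_sin R) mp).
by exists 1, 0%N => p; rewrite mul1r expr0 ler_norml sin_geN1 sin_le1.
Qed.

Lemma deriv_along_scaled_phase s :
  deriv_along theta (fun p => s * phi p) (fun p => s * slope p).
Proof.
have := deriv_alongM (deriv_along_snd theta (fun=> s))
  (deriv_along_phase c theta1 m0).
by under [X in deriv_along _ _ X]funext do rewrite mulr0 addr0.
Qed.

Lemma Rintegral_rapidD f g : rapid f -> rapid g ->
  \int[nu]_p (f p + g p) = \int[nu]_p f p + \int[nu]_p g p.
Proof. by move=> rf rg; apply: RintegralD => //; exact: rapid_integrable. Qed.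

Lemma Rintegral_rapidZ k f : rapid f ->
  \int[nu]_p (k * f p) = k * \int[nu]_p f p.
Proof. by move=> rf; apply: RintegralZl => //; exact: rapid_integrable. Qed.

Lemma oscillatory_bound0 f k : tempered k -> (forall p, `|k p| <= 1) -> rapid f ->
  `|\int[nu]_p (k p * f p)| <= \int[nu]_p `|f p|.
Proof.
move=> tk k1 rf.
have ikf := rapid_integrable kappa_fin (rapidMl tk rf).
have if' := rapid_integrable kappa_fin rf.
apply: le_trans (le_normr_Rintegral _ ikf) _ => //.
apply: le_Rintegral => //.
- exact: integrable_norm ikf.
- exact: integrable_norm if'.
by move=> p _; rewrite /= normrM ler_piMl.
Qed.

(** With [g = f / slope], the derivative of [sin (s phi) * g] is [s cos (s phi) f + sin (s phi) g'],
    and its integral is zero. *)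
Lemma integral_cos_phase s f g g' : rapid f -> rapid g -> rapid g' ->
  deriv_along theta g g' -> (forall p, slope p * g p = f p) ->
  s * \int[nu]_p (cos (s * phi p) * f p) = - \int[nu]_p (sin (s * phi p) * g' p).
Proof.
move=> rf rg rg' gg' gf.
have dsin := deriv_along_comp (deriv_along_scaled_phase s)
  (fun p => is_derive_sin (s * phi p)).
have dF := deriv_alongM dsin gg'.
have rs := rapidMl (tempered_sin_phase s) rg'.
have rc := rapidMl (tempered_cos_phase s) rf.
have rsc := rapidMl (symbol_base (smooth_tempered_cst Y theta s 0)) rc.
apply/eqP; rewrite -addr_eq0 addrC -Rintegral_rapidZ// -Rintegral_rapidD//.
have rF := rapidMl (tempered_sin_phase s) rg.
apply/eqP; rewrite -(integral_deriv_along kappa_fin theta1 rF _ dF).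
  by apply: eq_Rintegral => p _; rewrite -gf; ring.
rewrite (_ : (fun p => _) = (fun p => sin (s * phi p) * g' p +
   s * (cos (s * phi p) * f p))); first exact: rapidD.
by apply/funext => p; rewrite -gf; ring.
Qed.

Lemma integral_sin_phase s f g g' : rapid f -> rapid g -> rapid g' ->
  deriv_along theta g g' -> (forall p, slope p * g p = f p) ->
  s * \int[nu]_p (sin (s * phi p) * f p) = \int[nu]_p (cos (s * phi p) * g' p).
Proof.
move=> rf rg rg' gg' gf.
have dcos := deriv_along_comp (deriv_along_scaled_phase s)
  (fun p => is_derive_cos (s * phi p)).
have dF := deriv_alongM dcos gg'.
have rc := rapidMl (tempered_cos_phase s) rg'.
have rs := rapidMl (tempered_sin_phase s) rf.
have rsc := rapidMl (symbol_base (smooth_tempered_cst Y theta (- s) 0)) rs.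
apply/eqP; rewrite eq_sym -subr_eq0 -mulNr -Rintegral_rapidZ// -Rintegral_rapidD//.
have rF := rapidMl (tempered_cos_phase s) rg.
apply/eqP; rewrite -(integral_deriv_along kappa_fin theta1 rF _ dF).
  by apply: eq_Rintegral => p _; rewrite -gf; ring.
rewrite (_ : (fun p => _) = (fun p => cos (s * phi p) * g' p +
   (- s) * (sin (s * phi p) * f p))); first exact: rapidD.
by apply/funext => p; rewrite -gf; ring.
Qed.

(** One step replaces [f] by the derivative of [f / slope], consumes one order of the symbol and
    exchanges cosine with sine; hence both bounds are proved together, with the constant passed on
    unchanged. *)
Lemma oscillatory_decay N f : symbol theta (@rapid R d dY Y) N f ->
  exists C, forall s, 0 < s ->
    `|\int[nu]_p (cos (s * phi p) * f p)| <= C / s ^+ N /\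
    `|\int[nu]_p (sin (s * phi p) * f p)| <= C / s ^+ N.
Proof.
elim: N f => [|N IH] f sf.
  have rf := symbol_base sf.
  exists (\int[nu]_p `|f p|) => s s0; rewrite expr0 divr1.
  split; apply: oscillatory_bound0 => //.
  - exact: tempered_cos_phase.
  - by move=> p; rewrite ler_norml cos_geN1 cos_le1.
  - exact: tempered_sin_phase.
  - by move=> p; rewrite ler_norml sin_geN1 sin_le1.
have sg := symbol_rapidMl (smooth_tempered_phase_slopeV theta1 m0 mc c1) sf.
have [rg [g' gg' sg']] := sg.
have [C HC] := IH _ sg'.
have gf p : slope p * ((slope p)^-1 * f p) = f p.
  by rewrite mulVKf// gt_eqF// phase_slope_gt0.
have rf := symbol_base sf; have rg' := symbol_base sg'.
exists C => s s0; have [Ccos Csin] := HC s s0.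
have sn0 : s != 0 by rewrite gt_eqF.
split.
  have := integral_cos_phase s rf rg rg' gg' gf.
  move/(congr1 (fun x => s^-1 * x)); rewrite mulKf// => ->.
  rewrite normrM normrN gtr0_norm ?invr_gt0// exprSr invfM mulrA mulrC.
  by rewrite ler_wpM2r// invr_ge0 ltW.
have := integral_sin_phase s rf rg rg' gg' gf.
move/(congr1 (fun x => s^-1 * x)); rewrite mulKf// => ->.
rewrite normrM gtr0_norm ?invr_gt0// exprSr invfM mulrA mulrC.
by rewrite ler_wpM2r// invr_ge0 ltW.
Qed.

End oscillatory_integral.

(** * Finite area of the sphere *)

Section sphere_measure_finite.
Variable R : realType.
Local Open Scope ereal_scope.
Local Notation lam := (@lebesgue_measure R).

Lemma continuous_arc_density (r x : R) : (0 < r ^+ 2 - x ^+ 2)%R ->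
  {for x, continuous (fun a : R => (Num.sqrt (r ^+ 2 - a ^+ 2))^-1)%R}.
Proof.
move=> rx; apply: cvgV; first by rewrite sqrtr_eq0 -ltNge.
apply: (@continuous_comp _ _ _ (fun a : R => r ^+ 2 - a ^+ 2)%R (@Num.sqrt R)).
  by apply: cvgB; [exact: cvg_cst|exact: exprn_continuous].
exact: sqrt_continuous.
Qed.

Lemma measurable_arc_density (r : R) :
  measurable_fun [set: measurableTypeR R] (fun a => (Num.sqrt (r ^+ 2 - a ^+ 2))^-1)%R.
Proof.
rewrite (_ : (fun _ => _) =
    (fun z => z `^ (-1))%R \o (fun a => Num.sqrt (r ^+ 2 - a ^+ 2)%R)); last first.
  by apply/funext => y /=; rewrite powR_inv1// sqrtr_ge0.
apply: measurableT_comp; first exact: measurable_powR.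
apply: (measurableT_comp (@measurable_sqrt R)).
by apply: measurable_funB => //; exact: measurable_funX.
Qed.

Lemma is_derive_arcsin (r x : R) : (0 < r)%R -> (`|x| < r)%R ->
  is_derive x 1%R (fun a : R => asin (a / r)) ((Num.sqrt (r ^+ 2 - x ^+ 2))^-1)%R.
Proof.
move=> r0 xr.
have xr1 : (-1 < x / r < 1)%R by rewrite -ltr_norml normrM normfV (gtr0_norm r0)
  ltr_pdivrMr// mul1r.
have d1 : is_derive x 1%R (fun a : R => a / r)%R r^-1%R.
  by apply: is_derive_eq; rewrite /GRing.scale/=; ring.
have := @is_derive1_comp _ _ (fun a => a / r)%R _ _ _ (is_derive1_asin xr1) d1.
rewrite (_ : r ^+ 2 - x ^+ 2 = r ^+ 2 * (1 - (x / r) ^+ 2))%R; last first.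
  by field; rewrite gt_eqF.
by rewrite sqrtrM ?sqr_ge0// sqrtr_sqr (gtr0_norm r0) mulrC invfM.
Qed.

(** The density blows up at [-r] and [r], so the fundamental theorem is applied on a smaller closed
    segment, with antiderivative [asin (a / r)]; its values lie between [- pi / 2] and [pi / 2],
    hence the bound [pi]. *)
Lemma arc_length_segment (r u : R) : (0 < u < r)%R ->
  \int[lam]_(x in `[(- u)%R, u]) ((Num.sqrt (r ^+ 2 - x ^+ 2))^-1)%:E <= pi%:E.
Proof.
move=> /andP[u0 ur]; have r0 := lt_trans u0 ur.
have absx (x : R) : x \in `[(- u)%R, u] -> (`|x| < r)%R.
  by rewrite in_itv/= -ler_norml => /le_lt_trans; apply.
have pos (x : R) : x \in `[(- u)%R, u] -> (0 < r ^+ 2 - x ^+ 2)%R.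
  by move=> /absx xr; rewrite subr_gt0 -(real_normK (num_real x)) ltrXn2r// ?nnegrE ltW.
have cF (x : R) : x \in `[(- u)%R, u] ->
    {for x, continuous (fun a : R => asin (a / r))%R}.
  move=> /absx /(is_derive_arcsin r0)[dx _].
  exact/differentiable_continuous/derivable1_diffP.
have uin : u \in `[(- u)%R, u] by rewrite in_itv/= lexx andbT; lra.
have Nuin : (- u)%R \in `[(- u)%R, u] by rewrite in_itv/= lexx/=; lra.
rewrite (@continuous_FTC2 _ _ (fun a : R => asin (a / r))%R).
- rewrite -EFinB lee_fin.
  have b v : (`|v| < r)%R -> (-1 <= v / r <= 1)%R.
    by move=> vr; rewrite -ler_norml normrM normfV (gtr0_norm r0)
      ler_pdivrMr// mul1r ltW.
  have := asin_lepi2 (b _ (absx _ uin)); have := asin_geNpi2 (b _ (absx _ Nuin)).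
  lra.
- lra.
- apply: continuous_in_subspaceT => x /[!inE] xu.
  by apply: continuous_arc_density; exact: pos.
- split.
  + move=> x /subset_itv_oo_cc/absx /(is_derive_arcsin r0)[dx _]; exact: dx.
  + by apply: cvg_at_right_filter; exact: cF.
  + by apply: cvg_at_left_filter; exact: cF.
- move=> x /subset_itv_oo_cc/absx xr; rewrite derive1E.
  by have [_ ->] := is_derive_arcsin r0 xr.
Qed.

Lemma arc_length_le (r : R) : (0 < r)%R ->
  \int[lam]_(x in `](- r)%R, r[) ((Num.sqrt (r ^+ 2 - x ^+ 2))^-1)%:E <= pi%:E.
Proof.
(* An exhaustion of the open interval for monotone convergence; [n.+2] makes already the first
   segment nondegenerate. *)
move=> r0; pose u n : R := (r - r / n.+2%:R)%R.
have u_lt n : (0 < u n < r)%R.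
  rewrite /u subr_gt0 ltrBlDr ltrDl divr_gt0 ?ltr0n// andbT.
  by rewrite ltr_pdivrMr ?ltr0n// ltr_pMr// ltr1n.
have -> : `](- r)%R, r[%classic = \bigcup_n `[(- u n)%R, u n]%classic.
  apply/seteqP; split=> x /=; last first.
    move=> [n _] /=; rewrite !in_itv/= -ler_norml -ltr_norml => /le_lt_trans; apply.
    by have /andP[] := u_lt n.
  rewrite in_itv/= -ltr_norml => xr.
  have rx : (0 < r - `|x|)%R by rewrite subr_gt0.
  exists (Num.bound (r / (r - `|x|))) => //=.
  rewrite in_itv/= -ler_norml /u lerBrDr addrC -lerBrDr.
  rewrite ler_pdivrMr ?ltr0n// mulrC -ler_pdivrMr//.
  apply/ltW/(lt_trans (archi_boundP _)); first by rewrite divr_ge0// ltW.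
  by rewrite ltr_nat.
have lim := @ge0_nondecreasing_set_cvg_integral _ (measurableTypeR R) R
  (fun n => `[(- u n)%R, u n]%classic)
  (fun x => ((Num.sqrt (r ^+ 2 - x ^+ 2))^-1)%:E) lam.
suff lim' : \int[lam]_(x in `[(- u n)%R, u n]) ((Num.sqrt (r ^+ 2 - x ^+ 2))^-1)%:E
    @[n --> \oo] --> \int[lam]_(x in \bigcup_n `[(- u n)%R, u n]%classic)
    ((Num.sqrt (r ^+ 2 - x ^+ 2))^-1)%:E.
  rewrite -(cvg_lim _ lim')//; apply: lime_le; first exact: cvgP lim'.
  by apply: nearW => n; exact: arc_length_segment.
apply: lim => //.
- apply/nondecreasing_seqP => n; rewrite subsetEset.
  apply: subset_itv; rewrite bnd_simp ?lerN2 /u lerB// ler_pM2l// lef_pV2 ?posrE ?ltr0n//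
    ler_nat//.
- move=> n; apply/measurable_EFinP; apply: measurable_funTS.
  exact: measurable_arc_density.
Qed.

Lemma uballE (n : nat) (y : 'rV[R]_n) : @uball R n y <-> (dotp y y < 1)%R.
Proof. by rewrite /uball/= /enorm -[X in (_ < X)%R]sqrtr1 ltr_sqrt. Qed.

Lemma dotp_leb_cons (n : nat) (x : R) (y : 'rV[R]_n) :
  (dotp (leb_cons (x, y)) (leb_cons (x, y)) = x ^+ 2 + dotp y y)%R.
Proof.
rewrite /dotp big_ord_recl !mxE unlift_none/= expr2; congr (_ + _)%R.
by apply: eq_bigr => i _; rewrite !mxE liftK.
Qed.

(** Integrating the first coordinate out leaves the length of a half circle,
    [pi], over the ball of one dimension less. *)
Lemma area_lty (n : nat) :
  \int[leb R n]_(y in @uball R n) (area_density y)%:E < +oo.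
Proof.
case: n => [|n].
  apply: (@le_lt_trans _ _ (\int[leb R 0]_(y in @uball R 0) (1%R)%:E)).
    apply: ge0_le_integral => //.
    - exact: measurable_uball.
    - by move=> y _; rewrite lee_fin area_density_ge0.
    - by apply/measurable_EFinP; apply: measurable_funTS; exact: measurable_area_density.
    - by move=> y _; rewrite lee_fin /area_density /dotp big_ord0 subr0 sqrtr1 invr1.
  by rewrite integral_cst ?mul1e /= ?diracE ?ltry//; exact: measurable_uball.
rewrite integral_mkcond/=.
set g := _ \_ _.
have g0 y : 0 <= g y.
  by rewrite /g; apply: erestrict_ge0 => {}y _; rewrite lee_fin area_density_ge0.
have mg : measurable_fun setT g.
  apply/(measurable_restrictT _ (@measurable_uball R n.+1)).
  by apply/measurable_EFinP; apply: measurable_funTS; exact: measurable_area_density.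
rewrite /leb_step (ge0_integral_pushforward (@measurable_leb_cons R n))//.
rewrite preimage_setT fubini_tonelli2//=; last first.
  exact: (measurableT_comp mg (@measurable_leb_cons R n)).
(* On the unit ball the weight is at most 2, so [pi <= K / weight y ^+ n] there. This majorant is
   integrable over the whole space, and the volume of the ball is never computed. *)
pose K : R := (pi * 2 ^+ n)%R.
have K0 : (0 <= K)%R by rewrite mulr_ge0// ?pi_ge0// exprn_ge0.
have w0 (y : 'rV[R]_n) : (0 <= (weight y ^+ n)^-1)%R.
  by rewrite invr_ge0 ltW// weightX_gt0.
have mw : measurable_fun setT (fun y : 'rV[R]_n => ((weight y ^+ n)^-1)%:E).
  by apply/measurable_EFinP; exact: measurable_weightXV.
apply: (@le_lt_trans _ _ (\int[leb R n]_y (K%:E * ((weight y ^+ n)^-1)%:E))); last first.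
  rewrite ge0_integralZl//; last by move=> y _; rewrite lee_fin.
  rewrite lte_mul_pinfty// ?weightV_integral_lty//.
apply: ge0_le_integral => //.
- by move=> y _; apply: integral_ge0 => x _; exact: g0.
- apply: measurable_fun_fubini_tonelli_G => [|z]; last exact: g0.
  exact: (measurableT_comp mg (@measurable_leb_cons R n)).
- exact: measurable_funeM.
move=> y _; rewrite /fubini_G/=.
have [y1|y1] := ltP (dotp y y) 1%R; last first.
  rewrite integral0_eq; first by rewrite -EFinM lee_fin mulr_ge0.
  move=> x _; rewrite /g patchE memNset// => /uballE.
  by rewrite dotp_leb_cons ltNge (le_trans y1)// lerDr sqr_ge0.
pose r := Num.sqrt (1 - dotp y y).
have r0 : (0 < r)%R by rewrite sqrtr_gt0 subr_gt0.
have r2 : (r ^+ 2 = 1 - dotp y y)%R by rewrite sqr_sqrtr// subr_ge0 ltW.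
apply: (@le_trans _ _ pi%:E).
  apply: le_trans (arc_length_le r0); rewrite [leRHS]integral_mkcond.
  rewrite le_eqVlt; apply/orP; left; apply/eqP; apply: eq_integral => x _.
  rewrite /g !patchE.
  have -> : (leb_cons (x, y) \in @uball R n.+1) = (x \in `](- r)%R, r[%classic).
    apply/idP/idP; rewrite !inE.
      move=> /uballE; rewrite dotp_leb_cons /= in_itv/= -ltr_norml => xy.
      rewrite -(@ltr_pXn2r _ 2)// ?nnegrE// ?(ltW r0)// real_normK ?num_real// r2.
      by rewrite ltrBrDr.
    rewrite /= in_itv/= -ltr_norml => xr; apply/uballE.
    rewrite dotp_leb_cons -ltrBrDr -r2 -(real_normK (num_real x)).
    by rewrite ltrXn2r// ?nnegrE// ltW.
  case: ifP => // _; rewrite /area_density dotp_leb_cons r2.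
  by congr ((Num.sqrt _)^-1%R)%:E; ring.
rewrite -EFinM lee_fin /K -mulrA ler_peMr ?pi_ge0//.
rewrite -expr_div_n exprn_ege1// ler_pdivlMr ?weight_gt0// mul1r /weight.
lra.
Qed.

Lemma sphere_measure_setT_lty (n : nat) : @sphere_measure R n setT < +oo.
Proof.
rewrite /sphere_measure measure_addE lte_add_pinfty//;
  by rewrite /= /sphere_half preimage_setT setIT area_lty.
Qed.

End sphere_measure_finite.

(** * Continuous functions are measurable for the coordinate sigma-algebra *)

Section continuous_measurable_rV.
Variable R : realType.

(** Any preimage under [h \o g] is a countable union of fibers of [g], whatever [h] is. *)
Lemma countable_fibers_measurable (dT : measure_display) (T : measurableType dT)
    (I : countType) (g : T -> I) (h : I -> R) :
  (forall i, measurable (g @^-1` [set i])) -> measurable_fun setT (h \o g).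
Proof.
move=> mg _ B mB; rewrite setTI.
rewrite (_ : _ @^-1` _ = \bigcup_(i in h @^-1` B) g @^-1` [set i]).
  rewrite bigcup_mkcond; apply: countable_bigcupT_measurable => [|i].
    exact: countableP.
  by case: ifP.
by apply/seteqP; split=> [t Bt|t [i Bi gt]]; [exists (g t)|rewrite -gt in Bi].
Qed.

Definition floor_rV (n N : nat) (x : 'rV[R]_n) : 'rV[int]_n :=
  \row_i Num.floor (x 0 i * N.+1%:R).

Definition grid_rV (n N : nat) (z : 'rV[int]_n) : 'rV[R]_n :=
  \row_i ((z 0 i)%:~R / N.+1%:R).

Lemma measurable_floor_rV (n N : nat) (z : 'rV[int]_n) :
  measurable (@floor_rV n N @^-1` [set z]).
Proof.
rewrite (_ : _ @^-1` _ = \bigcap_(i in [set: 'I_n])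
    (fun x : 'rV[R]_n => x 0 i * N.+1%:R) @^-1` `[(z 0 i)%:~R, (z 0 i + 1)%:~R[%classic).
  apply: fin_bigcap_measurable => // i _; apply: measurable_preimage => //.
  by apply: measurable_funM => //; exact: measurable_rV_coord.
apply/seteqP; split=> [x <- i _|x xz].
  by rewrite /= !mxE in_itv/= floor_itv.
apply/rowP => i; rewrite !mxE; apply/eqP; rewrite floor_eq.
by have := xz i I; rewrite /= in_itv.
Qed.

Lemma grid_floor_dist (n N : nat) (x : 'rV[R]_n) i :
  `|x 0 i - grid_rV N (floor_rV N x) 0 i| <= N.+1%:R^-1.
Proof.
rewrite !mxE; have := floor_itv (x 0 i * N.+1%:R).
move: (Num.floor _) => z /andP[z1 z2].
have N0 : (0 : R) < N.+1%:R by rewrite ltr0n.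
have -> : x 0 i - z%:~R / N.+1%:R = (x 0 i * N.+1%:R - z%:~R) / N.+1%:R.
  by field; rewrite gt_eqF.
rewrite ger0_norm ?divr_ge0 ?subr_ge0// ler_pdivrMr// mulVf ?gt_eqF//.
by rewrite lerBlDl; move: z2; rewrite intrD => /ltW.
Qed.

(** [f] is the pointwise limit of its values on the grids of mesh [1 / N.+1]. *)
Lemma continuous_measurable_rV2 (k l : nat) (f : 'rV[R]_k * 'rV[R]_l -> R) :
  continuous f -> measurable_fun setT f.
Proof.
move=> cf.
pose D N (p : 'rV[R]_k * 'rV[R]_l) := (floor_rV N p.1, floor_rV N p.2).
pose G N (z : 'rV[int]_k * 'rV[int]_l) := (grid_rV N z.1, grid_rV N z.2).
apply: (@measurable_fun_cvg _ _ _ _ (fun N => (f \o G N) \o D N)) => [N|p _].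
  apply: countable_fibers_measurable => -[z w].
  rewrite (_ : _ @^-1` _ =
      (@floor_rV k N @^-1` [set z]) `*` (@floor_rV l N @^-1` [set w])).
    by apply: measurableX; exact: measurable_floor_rV.
  apply/seteqP; split=> -[x y] [] /=; first by move=> xz yw; split.
  by rewrite /D/= => -> ->.
apply: (@cvg_comp _ _ _ (fun N => G N (D N p)) f _ (nbhs p)); last exact: cf.
apply/cvg_ballP => e e0; near=> N.
have Ne : N.+1%:R^-1 < e.
  by near: N; exact: (near_infty_natSinv_lt (PosNum e0)).
by split; split=> // i j; rewrite ord1; exact: le_lt_trans (grid_floor_dist N _ j) Ne.
Unshelve. all: by end_near. Qed.

End continuous_measurable_rV.

(** * From Schwartz functions to rapid symbols *)

Section schwartz_symbols.
Variable R : realType.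

Lemma derivable_line (V : normedModType R) (f : V -> R) (x v : V) :
  derivable f x v -> is_derive (0 : R) 1 (fun h : R => f (x + h *: v)) ('D_v f x).
Proof.
move=> fxv.
have E : (fun h : R => h^-1 *: (((fun h : R => f (x + h *: v)) \o shift 0) (h *: 1) -
    f (x + 0 *: v))) = (fun h : R => h^-1 *: ((f \o shift x) (h *: v) - f x)).
  apply/funext => h /=; rewrite addr0 scale0r addr0 [_%:A]mulr1.
  by rewrite [x + _]addrC.
by apply: DeriveDef; rewrite /derivable /derive/= E.
Qed.

Lemma weight_le (d : nat) (x : 'rV[R]_d) : weight x <= (1 + enorm x) ^+ 2.
Proof.
have e2 : enorm x ^+ 2 = dotp x x by rewrite sqr_sqrtr// dotp_ge0.
have e0 : 0 <= enorm x by exact: sqrtr_ge0.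
rewrite /weight -e2; nra.
Qed.

(** Moving along [theta] leaves [y] fixed, so [\1_H] and [g] behave as constants and need only be
    measurable; the derivatives are those of [L] in the single direction [(theta, 0)]. *)
Lemma schwartz_smooth_rapid (d l : nat) (dY : measure_display)
    (Y : measurableType dY) (theta : 'rV[R]_d) (g : Y -> 'rV[R]_l) (H : set Y)
    (L : 'rV[R]_d * 'rV[R]_l -> R) :
  measurable H -> measurable_fun setT g -> schwartz L ->
  smooth_rapid theta (fun p => \1_H p.2 * L (p.1, g p.2)).
Proof.
move=> mH mg [sL rL].
pose v : 'rV[R]_d * 'rV[R]_l := (theta, 0).
pose F j (p : 'rV[R]_d * Y) := \1_H p.2 * iter_derive (nseq j v) L (p.1, g p.2).
suff sF j k : symbol theta (@rapid R d dY Y) k (F j) by move=> k; exact: (sF 0%N k).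
have rF i : rapid (F i).
  split.
    apply: measurable_funM.
      exact: (measurableT_comp (measurable_indic mH) measurable_snd).
    have mL : measurable_fun setT (iter_derive (nseq i v) L).
      by apply: continuous_measurable_rV2 => x; have [] := sL (nseq i v) x I.
    apply: (measurableT_comp mL); apply: measurable_fun_pair => //.
    exact: (measurableT_comp mg measurable_snd).
  (* The exponent doubles because the weight is only bounded by the square of [1 + enorm]. *)
  move=> N; have [C LC] := rL (nseq i v) (2 * N)%N; exists C => p.
  apply: le_trans (LC p.1 (g p.2)); rewrite exprM.
  apply: ler_pM => //; first exact/ltW/weightX_gt0.
    have w0 : 0 <= weight p.1 by exact/ltW/weight_gt0.
    by rewrite lerXn2r ?nnegrE ?sqr_ge0 ?weight_le.
  by rewrite normrM ler_piMl// ger0_norm.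
elim: k j => [|k IH] j; split=> //.
exists (F j.+1) => // xi y; rewrite /F/=.
have [_ dL] := sL (nseq j v) (xi, g y) I.
have dl := derivable_line (dL v).
have := is_deriveM (is_derive_cst (\1_H y : R) (0 : R) 1) dl.
rewrite /= scaler0 addr0 => h.
rewrite (_ : (fun h : R => _) = (cst (\1_H y : R) * (fun h : R =>
   iter_derive (nseq j v) L ((xi, g y) + h *: v)))%R)//.
by apply/funext => t /=; congr (_ * iter_derive _ _ (_, _)); rewrite /= scaler0 addr0.
Qed.

Lemma smooth_rapid0 (d : nat) (dY : measure_display) (Y : measurableType dY)
  (theta : 'rV[R]_d) : smooth_rapid theta (fun=> 0 : R) (Y := Y).
Proof.
elim=> [|k IH]; split=> //.
- by split=> // N; exists 0 => p; rewrite normr0 mulr0.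
- by split=> // N; exists 0 => p; rewrite normr0 mulr0.
by exists (fun=> 0) => //; exact: (deriv_along_snd theta (fun=> 0)).
Qed.

Lemma smooth_rapid_sum (d : nat) (dY : measure_display) (Y : measurableType dY)
    (theta : 'rV[R]_d) (I : Type) (r : seq I) (f : I -> 'rV[R]_d * Y -> R) :
  (forall i, smooth_rapid theta (f i)) ->
  smooth_rapid theta (fun p => \sum_(i <- r) f i p).
Proof.
move=> sf; elim: r => [|i r IH].
  by under [X in smooth_rapid _ X]funext do rewrite big_nil; exact: smooth_rapid0.
by under [X in smooth_rapid _ X]funext do rewrite big_cons; exact: smooth_rapidD.
Qed.

End schwartz_symbols.

(** * Gluing the amplitude from the hemispheres *)

Section sphere_atlas.
Variables (R : realType) (n : nat).
Implicit Type c : 'I_n.+1 * bool.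

Lemma measurable_enorm k : measurable_fun setT (@enorm R k).
Proof. exact: (measurableT_comp (@measurable_sqrt R) (@measurable_dotp R k)). Qed.

Lemma measurable_sphere k : measurable (@sphere R k).
Proof.
rewrite (_ : @sphere R k = @enorm R k @^-1` [set 1])//.
by apply: measurable_preimage => //; exact: measurable_enorm.
Qed.

Lemma measurable_hemisphere c : measurable (@hemisphere R n c).
Proof.
rewrite (_ : @hemisphere R n c = @sphere R n.+1 `&`
  (fun s : 'rV[R]_n.+1 => (-1) ^+ c.2 * s 0 c.1) @^-1` `]0, +oo[%classic).
  apply: measurableI; first exact: measurable_sphere.
  apply: measurable_preimage => //.
  by apply: measurable_funM => //; exact: measurable_rV_coord.
by apply/seteqP; split=> s /= [s1 s2]; split; rewrite // in_itv/= andbT in s2 *.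
Qed.

(** A projection defined on the whole ambient space, hence measurable there; it inverts the chart on
    the hemisphere only. *)
Definition chart_inv c (s : 'rV[R]_n.+1) : 'rV[R]_n := \row_k s 0 (lift c.1 k).

Lemma measurable_chart_inv c : measurable_fun setT (chart_inv c).
Proof.
apply/measurable_fun_rVP => i.
rewrite (_ : _ \o _ = rV_coord (lift c.1 i)); first exact: measurable_rV_coord.
by apply/funext => x; rewrite /= /rV_coord mxE.
Qed.

Lemma chart_invK c s : hemisphere c s ->
  enorm (chart_inv c s) < 1 /\ chart c (chart_inv c s) = s.
Proof.
move=> [/sphere_dotp s1 s0].
have sgn2 : (-1) ^+ c.2 * (-1) ^+ c.2 = 1 :> R by rewrite -expr2 sqrr_sign.
have dE : 1 - dotp (chart_inv c s) (chart_inv c s) = ((-1) ^+ c.2 * s 0 c.1) ^+ 2.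
  rewrite exprMn sqrr_sign mul1r -[X in X - _]s1 /dotp (bigD1_ord c.1)//= expr2.
  by under [X in _ - X]eq_bigr do rewrite !mxE; rewrite addrK.
split.
  by apply/uballE; rewrite -subr_gt0 dE exprn_gt0.
apply/rowP => i; rewrite mxE; case: unliftP => [j ->|->]; first by rewrite mxE.
by rewrite dE sqrtr_sqr gtr0_norm// mulrA sgn2 mul1r.
Qed.

(** On the sphere [P] is the sum of the [chi c * P], and each of these is a localized Schwartz
    function pulled back along [chart_inv]. The indicators cut off the points where the pullback has
    no meaning. *)
Lemma smooth_rapid_sphere (d : nat) (theta : 'rV[R]_d)
    (chi : 'I_n.+1 * bool -> 'rV[R]_n.+1 -> R) (P : 'rV[R]_d * 'rV[R]_n.+1 -> R) :
  partition_of_unity chi -> (forall c, schwartz (localize c (chi c) P)) ->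
  smooth_rapid theta (fun p => \1_(@sphere R n.+1) p.2 * P p).
Proof.
move=> [_ _ chi1 chi_supp] sP.
have -> : (fun p => \1_(@sphere R n.+1) p.2 * P p) = (fun p => \sum_c
    \1_(@hemisphere R n c) p.2 * localize c (chi c) P (p.1, chart_inv c p.2)).
  apply/funext => -[xi s] /=; rewrite indicE.
  have [s1|s1] := pselect (sphere s); last first.
    rewrite memNset// mul0r big1// => c _.
    by rewrite indicE memNset ?mul0r// => -[].
  rewrite mem_set// mul1r -[LHS]mul1r -(chi1 s s1) mulr_suml.
  apply: eq_bigr => c _; rewrite indicE.
  have [sc|sc] := pselect (hemisphere c s).
    have [e1 cK] := chart_invK sc.
    by rewrite mem_set// mul1r /localize/= e1 cK.
  (* Off the hemisphere [chi c] is zero, since its support lies inside. *)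
  rewrite memNset// mul0r [chi c s](_ : _ = 0) ?mul0r//.
  apply/eqP; apply: contra_notT sc => chis.
  by apply: (chi_supp c); apply: subset_closure.
apply: smooth_rapid_sum => c; apply: schwartz_smooth_rapid => //.
- exact: measurable_hemisphere.
- exact: measurable_chart_inv.
Qed.

End sphere_atlas.

(** * The estimate for the solution *)

Lemma normc_le (R : realType) (x y : R) : Normc.normc (x +i* y) <= `|x| + `|y|.
Proof.
rewrite /= -[leRHS]ger0_norm ?addr_ge0// -sqrtr_sqr ler_wsqrtr//.
rewrite sqrrD !real_normK ?num_real// lerD2r lerDl.
by rewrite mulrn_wge0// mulr_ge0.
Qed.

Lemma decay_powR (R : realType) (C N s : R) (k : nat) :
  0 <= C -> N <= k%:R -> 1 <= s -> C / s ^+ k <= C * s `^ (- N).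
Proof.
move=> C0 Nk s1; rewrite ler_wpM2l// -powR_mulrn ?(le_trans _ s1)//.
by rewrite -powRN ler_powR// lerN2.
Qed.

Theorem mainTheorem3 (R : realType) (d n : nat) (m : R)
    (a : 'rV[R]_d.+1 * 'rV[R]_n.+1 -> R[i])
    (hm : 0 < m) (ha : schwartz_hyperboloid m a)
    (theta : 'rV[R]_d.+1) (omega : 'rV[R]_n.+1)
    (htheta : sphere theta) (homega : sphere omega) (q N : R) :
  exists2 C : R, 0 < C &
    \forall s \near +oo,
      Normc.normc (solution m a ((s + q) *: theta) (s *: omega))
        <= C * s `^ (- N).
Proof.
have [chi chi_pou sA] := ha.
have theta1 := sphere_dotp htheta.
have omega1 := sphere_dotp homega.
pose S := @sphere R n.+1.
(* The surface measure lives on the ambient space; cutting off to the sphere makes [c] bounded by 1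
   at every point. *)
pose c (y : 'rV[R]_n.+1) : R := \1_S y * dotp omega y.
have mS : measurable S by exact: measurable_sphere.
have mc : measurable_fun setT c.
  apply: measurable_funM; first exact: measurable_indic.
  by apply: measurable_sum => i; apply: measurable_funM => //;
    exact: measurable_rV_coord.
have c1 y : `|c y| <= 1.
  rewrite /c indicE; have [yS|yS] := pselect (S y); last first.
    by rewrite memNset// mul0r normr0.
  rewrite mem_set// mul1r -(@ler_pXn2r _ 2)// ?nnegrE// expr1n.
  rewrite real_normK ?num_real// -(sphere_dotp yS).
  exact: unit_cauchy_schwarz.
pose l (p : 'rV[R]_d.+1 * 'rV[R]_n.+1) := dotp theta p.1.
pose B1 p : R := \1_S p.2 * complex.Re (amplitude m a p).
pose B2 p : R := \1_S p.2 * complex.Im (amplitude m a p).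
have sB1 : smooth_rapid theta B1.
  by apply: smooth_rapid_sphere chi_pou _ => j; case: (sA j).
have sB2 : smooth_rapid theta B2.
  by apply: smooth_rapid_sphere chi_pou _ => j; case: (sA j).
have [tcos tsin] := smooth_tempered_trig 'rV[R]_n.+1 theta1 q.
(* [f1] and [f2] are the real and imaginary parts of [exp (i q l) * (B1 + i B2)]. *)
pose f1 p := cos (q * l p) * B1 p + - (sin (q * l p) * B2 p).
pose f2 p := cos (q * l p) * B2 p + sin (q * l p) * B1 p.
have sf1 : smooth_rapid theta f1.
  apply: smooth_rapidD; first exact: smooth_rapidMl.
  by apply: smooth_rapidN; exact: smooth_rapidMl.
have sf2 : smooth_rapid theta f2.
  by apply: smooth_rapidD; exact: smooth_rapidMl.
(* An integer order above the real exponent [N]; the absolute value also covers negative [N]. *)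
pose k := Num.bound `|N|.
have Nk : N <= k%:R by apply/ltW/(le_lt_trans (ler_norm _))/archi_boundP.
pose nu := (leb R d.+1 \x @sphere_measure R n)%E.
pose phi := phase theta m c.
have kfin := sphere_measure_setT_lty R n.
have [C1 HC1] := oscillatory_decay kfin theta1 hm mc c1 (sf1 k).
have [C2 HC2] := oscillatory_decay kfin theta1 hm mc c1 (sf2 k).
have rcos f s : smooth_rapid theta f -> rapid (fun p => cos (s * phi p) * f p).
  by move=> sf; apply: rapidMl (symbol_base (sf 0%N)); exact: tempered_cos_phase.
have rsin f s : smooth_rapid theta f -> rapid (fun p => sin (s * phi p) * f p).
  by move=> sf; apply: rapidMl (symbol_base (sf 0%N)); exact: tempered_sin_phase.
pose K : R := (2 * pi) ^- (d.+1 + n.+1).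
have K0 : 0 <= K by rewrite invr_ge0 exprn_ge0// mulr_ge0// pi_ge0.
pose D := ([set: 'rV[R]_d.+1] `*` S).
have angle s xi (y : 'rV[R]_n.+1) : S y ->
    dotp ((s + q) *: theta) xi - dotp (s *: omega) y * energy m xi =
    s * phi (xi, y) + q * l (xi, y).
  move=> yS; rewrite !dotpZl /phi /phase /l /c indicE mem_set//=; ring.
have IRe s : \int[nu]_(p in D) complex.Re
    (expi (dotp ((s + q) *: theta) p.1 - dotp (s *: omega) p.2 * energy m p.1) *
     amplitude m a p) =
    \int[nu]_p (cos (s * phi p) * f1 p) + \int[nu]_p (- (sin (s * phi p) * f2 p)).
  rewrite -Rintegral_rapidD//; last 2 first.
  - exact: rcos.
  - by apply: rapidN; exact: rsin.
  rewrite Rintegral_mkcond; apply: eq_Rintegral => -[xi y] _.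
  rewrite patchE /f1 /f2 /B1 /B2 /= !indicE.
  have [yS|yS] := pselect (S y); last first.
    rewrite (memNset yS) memNset => [/=|[]//].
    by rewrite !mul0r !mulr0 oppr0 addr0 !mulr0 ?subr0 ?addr0.
  rewrite (mem_set yS) mem_set//= angle// /expi cosD sinD.
  case: (amplitude m a _) => A1 A2 /=; ring.
have IIm s : \int[nu]_(p in D) complex.Im
    (expi (dotp ((s + q) *: theta) p.1 - dotp (s *: omega) p.2 * energy m p.1) *
     amplitude m a p) =
    \int[nu]_p (cos (s * phi p) * f2 p) + \int[nu]_p (sin (s * phi p) * f1 p).
  rewrite -Rintegral_rapidD//; last 2 first.
  - exact: rcos.
  - exact: rsin.
  rewrite Rintegral_mkcond; apply: eq_Rintegral => -[xi y] _.
  rewrite patchE /f1 /f2 /B1 /B2 /= !indicE.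
  have [yS|yS] := pselect (S y); last first.
    rewrite (memNset yS) memNset => [/=|[]//].
    by rewrite !mul0r !mulr0 oppr0 addr0 !mulr0 ?subr0 ?addr0.
  rewrite (mem_set yS) mem_set//= angle// /expi cosD sinD.
  case: (amplitude m a _) => A1 A2 /=; ring.
(* The sign of the constants is read off from the bounds at [s = 1]. *)
have CC0 : 0 <= C1 + C2.
  have [h1 _] := HC1 1 ltr01; have [h2 _] := HC2 1 ltr01.
  rewrite expr1n !divr1 in h1 h2.
  by rewrite addr_ge0// (le_trans _ h1, le_trans _ h2).
(* Real and imaginary parts give four integrals, two bounded with each of [C1] and [C2]; the added 1
   makes the constant strictly positive. *)
exists (K * (2 * (C1 + C2)) + 1).
  by rewrite ltr_wpDl// !mulr_ge0.
near=> s.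
have s1 : 1 <= s by near: s; exact: nbhs_pinfty_ge.
have s0 : 0 < s by exact: lt_le_trans s1.
have [c1s s1s] := HC1 s s0; have [c2s s2s] := HC2 s s0.
have r2s : rapid (fun p => sin (s * phi p) * f2 p) by exact: rsin.
rewrite /solution /Cintegral Normc.normcM -/nu -/D IRe IIm.
have normK : Normc.normc (K%:C) = K.
  by rewrite /= expr0n/= addr0 sqrtr_sqr ger0_norm.
rewrite normK.
apply: (@le_trans _ _ (K * (2 * (C1 + C2)) / s ^+ k)); last first.
  apply: (@le_trans _ _ ((K * (2 * (C1 + C2)) + 1) / s ^+ k)).
    by rewrite ler_wpM2r ?invr_ge0 ?exprn_ge0 ?(ltW s0)// lerDl.
  by apply: decay_powR => //; rewrite addr_ge0// !mulr_ge0.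
rewrite -mulrA ler_wpM2l//.
apply: le_trans (normc_le _ _) _.
have -> : \int[nu]_p (- (sin (s * phi p) * f2 p)) =
    - \int[nu]_p (sin (s * phi p) * f2 p).
  rewrite -mulN1r -Rintegral_rapidZ//.
  by apply: eq_Rintegral => p _; rewrite mulN1r.
have -> : 2 * (C1 + C2) / s ^+ k =
    (C1 / s ^+ k + C2 / s ^+ k) + (C2 / s ^+ k + C1 / s ^+ k) by ring.
apply: lerD; apply: le_trans (ler_normD _ _) _; apply: lerD => //.
by rewrite normrN.
Unshelve. all: by end_near. Qed.
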